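(* Let $\mathbb{A}$ and $\mathbb{B}$ be double categories such that the underlying vertical category $U\mathbf{V}\mathbb{B}$ is a disjoint union of copies of $\mathbbm{1}$ and $\mathbbm{2}$. Then a double functor $F\colon\mathbb{A}\to\mathbb{B}$ is a double biequivalence if and only if there exist a normal horizontally pseudo double functor $G\colon\mathbb{B}\to\mathbb{A}$ and horizontal pseudo natural equivalences $\eta\colon\mathrm{id}_{\mathbb{A}}\simeq GF$ and $\epsilon\colon FG\simeq\mathrm{id}_{\mathbb{B}}$.
   Context: A double category has objects, horizontal morphisms, vertical morphisms and squares $\alpha\colon(u\,{}^{a}_{b}\,v)$ (top $a$, bottom $b$, left $u$, right $v$); $e_A$ is the vertical identity. $U\mathbf{V}\mathbb{B}$ is the category of objects and vertical morphisms of $\mathbb{B}$; $\mathbbm{1}$ the terminal category, $\mathbbm{2}=\{0\to1\}$. $\mathbf{H}\mathbb{A}$ is the underlying horizontal 2-category (2-cells: squares with identity vertical boundaries); $\mathcal{V}\mathbb{A}$ is the 2-category of vertical morphisms (objects), squares (morphisms from left to right boundary), and as 2-cells from $\alpha\colon(u\,{}^{a}_{b}\,v)$ to $\beta\colon(u\,{}^{c}_{d}\,v)$ pairs of squares $\sigma_0\colon(e\,{}^{a}_{c}\,e)$, $\sigma_1\colon(e\,{}^{b}_{d}\,e)$ with $\sigma_0$ on top of $\beta$ equal to $\alpha$ on top of $\sigma_1$. Horizontal equivalence: equivalence in $\mathbf{H}\mathbb{A}$. Weakly horizontally invertible square: equivalence in $\mathcal{V}\mathbb{A}$. Double biequivalence: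 a double functor $F\colon\mathbb{A}\to\mathbb{B}$ with (db1) every object $B$ of $\mathbb{B}$ admitting a horizontal equivalence $B\to FA$; (db2) for each horizontal $b\colon FA\to FC$ a horizontal $a\colon A\to C$ and a vertically invertible square $(e\,{}^{b}_{Fa}\,e)$; (db3) for each vertical $v\colon B\to B'$ a vertical $u$ in $\mathbb{A}$ and a weakly horizontally invertible square with left boundary $v$ and right boundary $Fu$; (db4) for each square $\beta\colon(Fu\,{}^{Fa}_{Fc}\,Fu')$ a unique $\alpha\colon(u\,{}^{a}_{c}\,u')$ with $F\alpha=\beta$. A horizontally pseudo double functor is given by maps on objects, horizontal and vertical morphisms and squares compatible with boundaries, preserving vertical composition and identities (of morphisms and squares) strictly, but preserving horizontal composition and identities only up to coherent vertically invertible squares (compositors/unitors with identity vertical boundaries), subject to associativity, unitality and naturality; it is normal if it preserves horizontal identities strictly. A horizontal pseudo natural transformation $h\colon F\Rightarrow G$ (between such functors) consists of horizontal morphisms $h_A\colon FA\to GA$, squares $h_u\colon(Fu\,{}^{h_A}_{h_{A'}}\,Gu)$ for vertical $u$, and vertically invertible squares $h_a\colon(e\,{}^{Ga\circ h_A}_{h_B\circ Fa}\,e)$ for horizontal $a$, coherent with compositions and natural with respect to squares; it is a horizontal pseudo natural equivalence if all $h_A$ are horizontal equivalences and all $h_u$ are weakly horizontally invertible. *)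

(* Defs.v *)
From Stdlib Require Import JMeq.
Set Implicit Arguments.
Unset Strict Implicit.

(* sq a b u v : square with top a : A -> B, bottom b : C -> D,         *)
(*              left u : A -> C, right v : B -> D.                     *)
(* sqh s t  : s to the left of t;  sqv s t : s on top of t.            *)
Unset Implicit Arguments.
Record DblData : Type := MkDblData {
  ob : Type;
  hom : ob -> ob -> Type;
  ver : ob -> ob -> Type;
  sq : forall (A B C D : ob), hom A B -> hom C D -> ver A C -> ver B D -> Type;
  hid : forall A, hom A A;
  hcmp : forall A B C, hom B C -> hom A B -> hom A C;
  vid : forall A, ver A A;
  vcmp : forall A B C, ver B C -> ver A B -> ver A C;
  sqh1 : forall A C (u : ver A C), sq A A C C (hid A) (hid C) u u;
  sqv1 : forall A B (a : hom A B), sq A B A B a a (vid A) (vid B);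
  sqh : forall A B E C D F (a : hom A B) (a' : hom B E) (b : hom C D) (b' : hom D F)
          (u : ver A C) (v : ver B D) (w : ver E F),
          sq A B C D a b u v -> sq B E D F a' b' v w ->
          sq A E C F (hcmp A B E a' a) (hcmp C D F b' b) u w;
  sqv : forall A B C D E F (a : hom A B) (b : hom C D) (c : hom E F)
          (u : ver A C) (v : ver B D) (u' : ver C E) (v' : ver D F),
          sq A B C D a b u v -> sq C D E F b c u' v' ->
          sq A B E F a c (vcmp A C E u' u) (vcmp B D F v' v)
}.

Set Implicit Arguments.
Arguments hom {_} _ _.
Arguments ver {_} _ _.
Arguments sq {_ _ _ _ _} _ _ _ _.
Arguments hid {_} _.
Arguments hcmp {_ _ _ _} _ _.
Arguments vid {_} _.
Arguments vcmp {_ _ _ _} _ _.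
Arguments sqh1 {_ _ _} _.
Arguments sqv1 {_ _ _} _.
Arguments sqh {_ _ _ _ _ _ _ _ _ _ _ _ _ _} _ _.
Arguments sqv {_ _ _ _ _ _ _ _ _ _ _ _ _ _} _ _.

Record IsDblCat (DD : DblData) : Prop := {
  hcmpA : forall (W X Y Z : ob DD) (a : hom W X) (b : hom X Y) (c : hom Y Z),
      hcmp c (hcmp b a) = hcmp (hcmp c b) a;
  hcmp1l : forall (X Y : ob DD) (a : hom X Y), hcmp (hid Y) a = a;
  hcmp1r : forall (X Y : ob DD) (a : hom X Y), hcmp a (hid X) = a;
  vcmpA : forall (W X Y Z : ob DD) (u : ver W X) (v : ver X Y) (w : ver Y Z),
      vcmp w (vcmp v u) = vcmp (vcmp w v) u;
  vcmp1l : forall (X Y : ob DD) (u : ver X Y), vcmp (vid Y) u = u;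
  vcmp1r : forall (X Y : ob DD) (u : ver X Y), vcmp u (vid X) = u;
  sqhA : forall (X0 X1 X2 X3 Y0 Y1 Y2 Y3 : ob DD)
      (a1 : hom X0 X1) (a2 : hom X1 X2) (a3 : hom X2 X3)
      (b1 : hom Y0 Y1) (b2 : hom Y1 Y2) (b3 : hom Y2 Y3)
      (u0 : ver X0 Y0) (u1 : ver X1 Y1) (u2 : ver X2 Y2) (u3 : ver X3 Y3)
      (s1 : sq a1 b1 u0 u1) (s2 : sq a2 b2 u1 u2) (s3 : sq a3 b3 u2 u3),
      JMeq (sqh s1 (sqh s2 s3)) (sqh (sqh s1 s2) s3);
  sqh1l : forall (X0 X1 Y0 Y1 : ob DD) (a : hom X0 X1) (b : hom Y0 Y1)
      (u : ver X0 Y0) (v : ver X1 Y1) (s : sq a b u v),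
      JMeq (sqh (sqh1 u) s) s;
  sqh1r : forall (X0 X1 Y0 Y1 : ob DD) (a : hom X0 X1) (b : hom Y0 Y1)
      (u : ver X0 Y0) (v : ver X1 Y1) (s : sq a b u v),
      JMeq (sqh s (sqh1 v)) s;
  sqvA : forall (X0 X1 Y0 Y1 Z0 Z1 W0 W1 : ob DD)
      (a : hom X0 X1) (b : hom Y0 Y1) (c : hom Z0 Z1) (d : hom W0 W1)
      (u0 : ver X0 Y0) (v0 : ver X1 Y1) (u1 : ver Y0 Z0) (v1 : ver Y1 Z1)
      (u2 : ver Z0 W0) (v2 : ver Z1 W1)
      (s1 : sq a b u0 v0) (s2 : sq b c u1 v1) (s3 : sq c d u2 v2),
      JMeq (sqv s1 (sqv s2 s3)) (sqv (sqv s1 s2) s3);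
  sqv1l : forall (X0 X1 Y0 Y1 : ob DD) (a : hom X0 X1) (b : hom Y0 Y1)
      (u : ver X0 Y0) (v : ver X1 Y1) (s : sq a b u v),
      JMeq (sqv (sqv1 a) s) s;
  sqv1r : forall (X0 X1 Y0 Y1 : ob DD) (a : hom X0 X1) (b : hom Y0 Y1)
      (u : ver X0 Y0) (v : ver X1 Y1) (s : sq a b u v),
      JMeq (sqv s (sqv1 b)) s;
  sqh1_vcmp : forall (X Y Z : ob DD) (u : ver X Y) (v : ver Y Z),
      sqh1 (vcmp v u) = sqv (sqh1 u) (sqh1 v);
  sqh1_vid : forall X : ob DD, sqh1 (vid X) = sqv1 (hid X);
  sqv1_hcmp : forall (X Y Z : ob DD) (a : hom X Y) (b : hom Y Z),
      sqv1 (hcmp b a) = sqh (sqv1 a) (sqv1 b);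
  interchange : forall (X0 X1 X2 Y0 Y1 Y2 Z0 Z1 Z2 : ob DD)
      (a : hom X0 X1) (a' : hom X1 X2) (b : hom Y0 Y1) (b' : hom Y1 Y2)
      (c : hom Z0 Z1) (c' : hom Z1 Z2)
      (u : ver X0 Y0) (v : ver X1 Y1) (w : ver X2 Y2)
      (u' : ver Y0 Z0) (v' : ver Y1 Z1) (w' : ver Y2 Z2)
      (s1 : sq a b u v) (s2 : sq a' b' v w) (s3 : sq b c u' v') (s4 : sq b' c' v' w'),
      sqv (sqh s1 s2) (sqh s3 s4) = sqh (sqv s1 s3) (sqv s2 s4)
}.

Record DblCat : Type := MkDblCat { dd :> DblData; dax : IsDblCat dd }.

Definition sqcast (DD : DblData) (X Y Z W : ob DD) (a a' : hom X Y) (b b' : hom Z W)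
  (u u' : ver X Z) (v v' : ver Y W)
  (ea : a = a') (eb : b = b') (eu : u = u') (ev : v = v') (s : sq a b u v) :
  sq a' b' u' v' :=
  match ea in _ = a1 return sq a1 b' u' v' with eq_refl =>
  match eb in _ = b1 return sq a b1 u' v' with eq_refl =>
  match eu in _ = u1 return sq a b u1 v' with eq_refl =>
  match ev in _ = v1 return sq a b u v1 with eq_refl => s end end end end.

Definition vinv (DD : DblData) (X Y : ob DD) (a b : hom X Y)
  (s : sq a b (vid X) (vid Y)) : Prop :=
  exists t : sq b a (vid X) (vid Y),
    JMeq (sqv s t) (sqv1 a) /\ JMeq (sqv t s) (sqv1 b).

(* Horizontal equivalence: equivalence in the 2-category H(DD)
   (2-cells = squares with identity vertical boundaries). *)
Definition hequiv (DD : DblData) (X Y : ob DD) (f : hom X Y) : Prop :=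
  exists (g : hom Y X) (s : sq (hcmp g f) (hid X) (vid X) (vid X))
         (t : sq (hcmp f g) (hid Y) (vid Y) (vid Y)), vinv s /\ vinv t.

(* 2-cells of the 2-category V(DD): from al : (u ^a_b v) to be : (u ^c_d v),
   pairs (s0 : e ^a_c e, s1 : e ^b_d e) with s0 on top of be = al on top of s1. *)
Definition va_cell (DD : DblData) (X Y X' Y' : ob DD) (u : ver X X') (v : ver Y Y')
  (a c : hom X Y) (b d : hom X' Y') (al : sq a b u v) (be : sq c d u v)
  (s0 : sq a c (vid X) (vid Y)) (s1 : sq b d (vid X') (vid Y')) : Prop :=
  JMeq (sqv s0 be) (sqv al s1).

(* Invertible 2-cell of V(DD) between al and be (2-cells compose
   componentwise by vertical composition; identities are (e_a, e_b)). *)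
Definition va_iso (DD : DblData) (X Y X' Y' : ob DD) (u : ver X X') (v : ver Y Y')
  (a c : hom X Y) (b d : hom X' Y') (al : sq a b u v) (be : sq c d u v) : Prop :=
  exists (s0 : sq a c (vid X) (vid Y)) (s1 : sq b d (vid X') (vid Y'))
         (t0 : sq c a (vid X) (vid Y)) (t1 : sq d b (vid X') (vid Y')),
    va_cell al be s0 s1 /\ va_cell be al t0 t1 /\
    JMeq (sqv s0 t0) (sqv1 a) /\ JMeq (sqv t0 s0) (sqv1 c) /\
    JMeq (sqv s1 t1) (sqv1 b) /\ JMeq (sqv t1 s1) (sqv1 d).

(* Weakly horizontally invertible square: equivalence in V(DD)
   (morphisms u -> v are squares with left u, right v; composition sqh,
   identities sqh1). *)
Definition wh_inv (DD : DblData) (X Y X' Y' : ob DD) (u : ver X X') (v : ver Y Y')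
  (a : hom X Y) (b : hom X' Y') (al : sq a b u v) : Prop :=
  exists (c : hom Y X) (d : hom Y' X') (be : sq c d v u),
    va_iso (sqh al be) (sqh1 u) /\ va_iso (sqh be al) (sqh1 v).

Unset Implicit Arguments.
Record DFunData (A B : DblCat) : Type := MkDFunData {
  fo : ob A -> ob B;
  fh : forall X Y : ob A, hom X Y -> hom (fo X) (fo Y);
  fv : forall X Y : ob A, ver X Y -> ver (fo X) (fo Y);
  fs : forall (X Y Z W : ob A) (a : hom X Y) (b : hom Z W) (u : ver X Z) (v : ver Y W),
         sq a b u v -> sq (fh X Y a) (fh Z W b) (fv X Z u) (fv Y W v)
}.
Set Implicit Arguments.
Arguments fo {A B} _ _.
Arguments fh {A B} _ {X Y} _.
Arguments fv {A B} _ {X Y} _.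
Arguments fs {A B} _ {X Y Z W a b u v} _.

Record IsDFun (A B : DblCat) (F : DFunData A B) : Prop := {
  fh_cmp : forall (X Y Z : ob A) (a : hom X Y) (b : hom Y Z),
      fh F (hcmp b a) = hcmp (fh F b) (fh F a);
  fh_id : forall X : ob A, fh F (hid X) = hid (fo F X);
  fv_cmp : forall (X Y Z : ob A) (u : ver X Y) (v : ver Y Z),
      fv F (vcmp v u) = vcmp (fv F v) (fv F u);
  fv_id : forall X : ob A, fv F (vid X) = vid (fo F X);
  fs_h : forall (A0 B0 E0 C0 D0 F0 : ob A) (a : hom A0 B0) (a' : hom B0 E0)
      (b : hom C0 D0) (b' : hom D0 F0) (u : ver A0 C0) (v : ver B0 D0) (w : ver E0 F0)
      (s1 : sq a b u v) (s2 : sq a' b' v w),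
      JMeq (fs F (sqh s1 s2)) (sqh (fs F s1) (fs F s2));
  fs_v : forall (A0 B0 C0 D0 E0 F0 : ob A) (a : hom A0 B0) (b : hom C0 D0) (c : hom E0 F0)
      (u : ver A0 C0) (v : ver B0 D0) (u' : ver C0 E0) (v' : ver D0 F0)
      (s1 : sq a b u v) (s2 : sq b c u' v'),
      JMeq (fs F (sqv s1 s2)) (sqv (fs F s1) (fs F s2));
  fs_h1 : forall (X Y : ob A) (u : ver X Y), JMeq (fs F (sqh1 u)) (sqh1 (fv F u));
  fs_v1 : forall (X Y : ob A) (a : hom X Y), JMeq (fs F (sqv1 a)) (sqv1 (fh F a))
}.

Record DFun (A B : DblCat) : Type := MkDFun { fd :> DFunData A B; fax : IsDFun fd }.

Unset Implicit Arguments.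
Record HPFD (A B : DblCat) : Type := MkHPFD {
  po : ob A -> ob B;
  ph : forall X Y : ob A, hom X Y -> hom (po X) (po Y);
  pv : forall X Y : ob A, ver X Y -> ver (po X) (po Y);
  ps : forall (X Y Z W : ob A) (a : hom X Y) (b : hom Z W) (u : ver X Z) (v : ver Y W),
         sq a b u v -> sq (ph X Y a) (ph Z W b) (pv X Z u) (pv Y W v);
  pcomp : forall (X Y Z : ob A) (a : hom X Y) (b : hom Y Z),
         sq (hcmp (ph Y Z b) (ph X Y a)) (ph X Z (hcmp b a)) (vid (po X)) (vid (po Z));
  punit : forall X : ob A,
         sq (hid (po X)) (ph X X (hid X)) (vid (po X)) (vid (po X))
}.
Set Implicit Arguments.
Arguments po {A B} _ _.
Arguments ph {A B} _ {X Y} _.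
Arguments pv {A B} _ {X Y} _.
Arguments ps {A B} _ {X Y Z W a b u v} _.
Arguments pcomp {A B} _ {X Y Z} _ _.
Arguments punit {A B} _ _.

Record IsHPF (A B : DblCat) (G : HPFD A B) : Prop := {
  pv_cmp : forall (X Y Z : ob A) (u : ver X Y) (v : ver Y Z),
      pv G (vcmp v u) = vcmp (pv G v) (pv G u);
  pv_id : forall X : ob A, pv G (vid X) = vid (po G X);
  ps_v : forall (A0 B0 C0 D0 E0 F0 : ob A) (a : hom A0 B0) (b : hom C0 D0) (c : hom E0 F0)
      (u : ver A0 C0) (v : ver B0 D0) (u' : ver C0 E0) (v' : ver D0 F0)
      (s1 : sq a b u v) (s2 : sq b c u' v'),
      JMeq (ps G (sqv s1 s2)) (sqv (ps G s1) (ps G s2));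
  ps_v1 : forall (X Y : ob A) (a : hom X Y), JMeq (ps G (sqv1 a)) (sqv1 (ph G a));
  pcomp_vinv : forall (X Y Z : ob A) (a : hom X Y) (b : hom Y Z), vinv (pcomp G a b);
  punit_vinv : forall X : ob A, vinv (punit G X);
  p_assoc : forall (W X Y Z : ob A) (a : hom W X) (b : hom X Y) (c : hom Y Z),
      JMeq (sqv (sqh (sqv1 (ph G a)) (pcomp G b c)) (pcomp G a (hcmp c b)))
           (sqv (sqh (pcomp G a b) (sqv1 (ph G c))) (pcomp G (hcmp b a) c));
  p_unitl : forall (X Y : ob A) (a : hom X Y),
      JMeq (sqv (sqh (punit G X) (sqv1 (ph G a))) (pcomp G (hid X) a)) (sqv1 (ph G a));
  p_unitr : forall (X Y : ob A) (a : hom X Y),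
      JMeq (sqv (sqh (sqv1 (ph G a)) (punit G Y)) (pcomp G a (hid Y))) (sqv1 (ph G a));
  p_natc : forall (A0 B0 E0 C0 D0 F0 : ob A) (a : hom A0 B0) (a' : hom B0 E0)
      (b : hom C0 D0) (b' : hom D0 F0) (u : ver A0 C0) (v : ver B0 D0) (w : ver E0 F0)
      (s1 : sq a b u v) (s2 : sq a' b' v w),
      JMeq (sqv (sqh (ps G s1) (ps G s2)) (pcomp G b b'))
           (sqv (pcomp G a a') (ps G (sqh s1 s2)));
  p_natu : forall (X X' : ob A) (u : ver X X'),
      JMeq (sqv (sqh1 (pv G u)) (punit G X')) (sqv (punit G X) (ps G (sqh1 u)))
}.

Record HPF (A B : DblCat) : Type := MkHPF { hd :> HPFD A B; hax : IsHPF hd }.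

Definition hpf_normal (A B : DblCat) (G : HPFD A B) : Prop :=
  forall X : ob A, exists e : ph G (hid X) = hid (po G X),
    JMeq (punit G X) (sqv1 (hid (po G X))).

Definition idD (A : DblCat) : HPFD A A :=
  {| po := fun X => X;
     ph := fun X Y a => a;
     pv := fun X Y u => u;
     ps := fun X Y Z W a b u v s => s;
     pcomp := fun X Y Z a b => sqv1 (hcmp b a);
     punit := fun X => sqv1 (hid X) |}.

Definition compGF (A B : DblCat) (G : HPF B A) (F : DFun A B) : HPFD A A :=
  {| po := fun X => po G (fo F X);
     ph := fun X Y a => ph G (fh F a);
     pv := fun X Y u => pv G (fv F u);
     ps := fun X Y Z W a b u v s => ps G (fs F s);
     pcomp := fun X Y Z a b =>
       sqcast eq_refl (f_equal (fun t => ph G t) (eq_sym (fh_cmp (fax F) a b)))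
              eq_refl eq_refl (pcomp G (fh F a) (fh F b));
     punit := fun X =>
       sqcast eq_refl (f_equal (fun t => ph G t) (eq_sym (fh_id (fax F) X)))
              eq_refl eq_refl (punit G (fo F X)) |}.

Definition compFG (A B : DblCat) (F : DFun A B) (G : HPF B A) : HPFD B B :=
  {| po := fun Y => fo F (po G Y);
     ph := fun X Y b => fh F (ph G b);
     pv := fun X Y v => fv F (pv G v);
     ps := fun X Y Z W a b u v s => fs F (ps G s);
     pcomp := fun X Y Z a b =>
       sqcast (fh_cmp (fax F) (ph G a) (ph G b)) eq_refl
              (fv_id (fax F) (po G X)) (fv_id (fax F) (po G Z))
              (fs F (pcomp G a b));
     punit := fun X =>
       sqcast (fh_id (fax F) (po G X)) eq_refl
              (fv_id (fax F) (po G X)) (fv_id (fax F) (po G X))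
              (fs F (punit G X)) |}.

Unset Implicit Arguments.
Record HPNTD (A B : DblCat) (S T : HPFD A B) : Type := MkHPNTD {
  tc : forall X : ob A, hom (po S X) (po T X);
  tv : forall (X Y : ob A) (u : ver X Y), sq (tc X) (tc Y) (pv S u) (pv T u);
  th : forall (X Y : ob A) (a : hom X Y),
      sq (hcmp (ph T a) (tc X)) (hcmp (tc Y) (ph S a)) (vid (po S X)) (vid (po T Y))
}.
Set Implicit Arguments.
Arguments HPNTD {A B} S T.
Arguments tc {A B S T} _ _.
Arguments tv {A B S T} _ {X Y} _.
Arguments th {A B S T} _ {X Y} _.

Record IsHPNT (A B : DblCat) (S T : HPFD A B) (h : HPNTD S T) : Prop := {
  th_vinv : forall (X Y : ob A) (a : hom X Y), vinv (th h a);
  tv_cmp : forall (X Y Z : ob A) (u : ver X Y) (v : ver Y Z),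
      JMeq (tv h (vcmp v u)) (sqv (tv h u) (tv h v));
  tv_id : forall X : ob A, JMeq (tv h (vid X)) (sqv1 (tc h X));
  t_nat : forall (X Y X' Y' : ob A) (a : hom X Y) (b : hom X' Y')
      (u : ver X X') (v : ver Y Y') (al : sq a b u v),
      JMeq (sqv (th h a) (sqh (ps S al) (tv h v)))
           (sqv (sqh (tv h u) (ps T al)) (th h b));
  t_comp : forall (X Y Z : ob A) (a : hom X Y) (b : hom Y Z),
      JMeq (sqv (sqh (sqv1 (tc h X)) (pcomp T a b)) (th h (hcmp b a)))
           (sqv (sqv (sqcast eq_refl (hcmpA (dax B) (ph S a) (tc h Y) (ph T b))
                             eq_refl eq_refl (sqh (th h a) (sqv1 (ph T b))))
                     (sqh (sqv1 (ph S a)) (th h b)))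
                (sqcast (hcmpA (dax B) (ph S a) (ph S b) (tc h Z)) eq_refl
                        eq_refl eq_refl (sqh (pcomp S a b) (sqv1 (tc h Z)))));
  t_unit : forall X : ob A,
      JMeq (sqv (sqh (sqv1 (tc h X)) (punit T X)) (th h (hid X)))
           (sqh (punit S X) (sqv1 (tc h X)))
}.

Record HPNT (A B : DblCat) (S T : HPFD A B) : Type :=
  MkHPNT { td :> HPNTD S T; tax : IsHPNT td }.

Definition hpnt_equiv (A B : DblCat) (S T : HPFD A B) (h : HPNTD S T) : Prop :=
  (forall X : ob A, hequiv (tc h X)) /\
  (forall (X Y : ob A) (u : ver X Y), wh_inv (tv h u)).

Definition double_biequiv (A B : DblCat) (F : DFun A B) : Prop :=
  (forall Y : ob B, exists (X : ob A) (f : hom Y (fo F X)), hequiv f) /\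
  (forall (X Z : ob A) (b : hom (fo F X) (fo F Z)),
      exists (a : hom X Z) (s : sq b (fh F a) (vid (fo F X)) (vid (fo F Z))), vinv s) /\
  (forall (Y Y' : ob B) (v : ver Y Y'),
      exists (X X' : ob A) (u : ver X X') (a : hom Y (fo F X)) (b : hom Y' (fo F X'))
             (s : sq a b v (fv F u)), wh_inv s) /\
  (forall (X Z X' Z' : ob A) (a : hom X Z) (c : hom X' Z') (u : ver X X') (u' : ver Z Z')
          (be : sq (fh F a) (fh F c) (fv F u) (fv F u')),
      exists! al : sq a c u u', fs F al = be).

(* U V B is (isomorphic to) a disjoint union of copies of 1 and 2.     *)
(* The disjoint union indexed by I with kinds k : I -> bool (true = 2, *)
(* false = 1) has objects (i, x) with x = true only if k i = true      *)
(* (in a copy of 2, false = 0 and true = 1), and a unique morphism     *)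
(* (i, x) -> (j, y) iff i = j and x <= y, none otherwise.  Since it is *)
(* thin, an isomorphism of categories amounts to a bijection on        *)
(* objects with hom-sets of matching cardinality (0 or 1).             *)
Definition du_le (I : Type) (p q : I * bool) : Prop :=
  fst p = fst q /\ (snd p = true -> snd q = true).

Definition vdisj12 (B : DblCat) : Prop :=
  exists (I : Type) (k : I -> bool) (phi : ob B -> I * bool),
    (forall Y : ob B, snd (phi Y) = true -> k (fst (phi Y)) = true) /\
    (forall (i : I) (x : bool), (x = true -> k i = true) -> exists Y, phi Y = (i, x)) /\
    (forall Y Y' : ob B, phi Y = phi Y' -> Y = Y') /\
    (forall Y Y' : ob B,
        (du_le (phi Y) (phi Y') -> exists u : ver Y Y', forall u' : ver Y Y', u' = u) /\
        (ver Y Y' -> du_le (phi Y) (phi Y'))).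

(* Main.v *)
Require Import Defs.
From Stdlib Require Import JMeq ClassicalEpsilon ProofIrrelevance Program.Equality Setoid.

(** Whiskering with a weakly horizontally invertible square is bijective on squares.
    Given [F : A -> B], consider the comma double category whose objects are horizontal
    equivalences [e : F X -> Y], whose horizontal morphisms are pairs [(b, a)] with an
    invertible square [b e => e' (F a)], whose vertical morphisms are squares
    [(F u ^e_e' v)], and whose squares are compatible pairs of a square of [B] and one of
    [A].  If [F] is a double biequivalence, horizontal morphisms lift along the projection
    to [B], and squares lift uniquely once their right boundary is weakly horizontally
    invertible.  A section of the projection (strict on vertical morphisms, which is where
    the shape of the vertical category of [B] is used) followed by the projection to [A]
    is [G]; its structure squares are lifts of identities, so every coherence law holds by
    uniqueness of lifts.  The comparison squares of the comma category are the components
    of [epsilon], and [eta] lifts the identities of [F X] from [id : F X -> F X] to the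
    chosen object over [F X].  Conversely, whiskering with the components of [eta] and
    [epsilon] transports squares back and forth. *)

Set Implicit Arguments.
Unset Strict Implicit.

(** * Packed squares *)

(* [Undef] is the value of an undefined composite; with this convention associativity
   holds unconditionally on packed squares. *)
Inductive psq (D : DblData) : Type :=
| Pk (X Y Z W : ob D) (a : hom X Y) (b : hom Z W) (u : ver X Z) (v : ver Y W)
     (s : sq a b u v)
| Undef.
Arguments Undef {D}.
Notation "<[ s ]>" := (Pk s).

(** Composition is given by its graph: composability is the sharing of the index [v], so no
    transport along an equality of boundaries is written. *)
Inductive hrel (D : DblData) : psq D -> psq D -> psq D -> Prop :=
| Hrel (X0 X1 X2 Y0 Y1 Y2 : ob D) (a : hom X0 X1) (a' : hom X1 X2)
    (b : hom Y0 Y1) (b' : hom Y1 Y2) (u : ver X0 Y0) (v : ver X1 Y1) (w : ver X2 Y2)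
    (s : sq a b u v) (t : sq a' b' v w) : hrel <[s]> <[t]> <[sqh s t]>.

Inductive vrel (D : DblData) : psq D -> psq D -> psq D -> Prop :=
| Vrel (X0 X1 Y0 Y1 Z0 Z1 : ob D) (a : hom X0 X1) (b : hom Y0 Y1) (c : hom Z0 Z1)
    (u : ver X0 Y0) (v : ver X1 Y1) (u' : ver Y0 Z0) (v' : ver Y1 Z1)
    (s : sq a b u v) (t : sq b c u' v') : vrel <[s]> <[t]> <[sqv s t]>.

Definition pchoose (D : DblData) (R : psq D -> Prop) : psq D :=
  match excluded_middle_informative (exists r, R r) with
  | left e => proj1_sig (constructive_indefinite_description _ e)
  | right _ => Undef
  end.

Definition hc (D : DblData) (p q : psq D) : psq D := pchoose (hrel p q).
Definition vc (D : DblData) (p q : psq D) : psq D := pchoose (vrel p q).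
Notation "p ** q" := (hc p q) (at level 40, left associativity).
Notation "p // q" := (vc p q) (at level 45, left associativity).

Lemma pchoose_eq (D : DblData) (R : psq D -> Prop) r :
  R r -> (forall r', R r' -> r' = r) -> pchoose R = r.
Proof.
  intros Hr Hu. unfold pchoose.
  destruct (excluded_middle_informative _) as [e|n].
  - destruct (constructive_indefinite_description _ e) as [x Hx]; simpl; auto.
  - destruct n; eauto.
Qed.

Lemma pchoose_undef (D : DblData) (R : psq D -> Prop) :
  (forall r, ~ R r) -> pchoose R = Undef.
Proof.
  intros H. unfold pchoose. destruct (excluded_middle_informative _) as [ [r e]|n]; auto.
  destruct (H r e).
Qed.

Lemma hrel_fun (D : DblData) (p q r r' : psq D) : hrel p q r -> hrel p q r' -> r' = r.
Proof.
  intros H H'. destruct H. dependent destruction H'. reflexivity.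
Qed.

Lemma vrel_fun (D : DblData) (p q r r' : psq D) : vrel p q r -> vrel p q r' -> r' = r.
Proof.
  intros H H'. destruct H. dependent destruction H'. reflexivity.
Qed.

Lemma hc_rel (D : DblData) (p q r : psq D) : hrel p q r -> p ** q = r.
Proof. intros H. apply pchoose_eq; auto. intros; eapply hrel_fun; eauto. Qed.

Lemma vc_rel (D : DblData) (p q r : psq D) : vrel p q r -> p // q = r.
Proof. intros H. apply pchoose_eq; auto. intros; eapply vrel_fun; eauto. Qed.

Lemma pk_h (D : DblData) (X0 X1 X2 Y0 Y1 Y2 : ob D) (a : hom X0 X1) (a' : hom X1 X2)
    (b : hom Y0 Y1) (b' : hom Y1 Y2) (u : ver X0 Y0) (v : ver X1 Y1) (w : ver X2 Y2)
    (s : sq a b u v) (t : sq a' b' v w) : <[sqh s t]> = <[s]> ** <[t]>.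
Proof. symmetry; apply hc_rel; constructor. Qed.

Lemma pk_v (D : DblData) (X0 X1 Y0 Y1 Z0 Z1 : ob D)
    (a : hom X0 X1) (b : hom Y0 Y1) (c : hom Z0 Z1)
    (u : ver X0 Y0) (v : ver X1 Y1) (u' : ver Y0 Z0) (v' : ver Y1 Z1)
    (s : sq a b u v) (t : sq b c u' v') : <[sqv s t]> = <[s]> // <[t]>.
Proof. symmetry; apply vc_rel; constructor. Qed.

(** Packing hides in which form the boundaries are written, so the casts in the coherence laws
    disappear from equations between packed squares. *)
Lemma pk_cast (D : DblData) (X Y Z W : ob D) (a a' : hom X Y) (b b' : hom Z W)
  (u u' : ver X Z) (v v' : ver Y W)
  (ea : a = a') (eb : b = b') (eu : u = u') (ev : v = v') (s : sq a b u v) :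
  <[sqcast ea eb eu ev s]> = <[s]>.
Proof. destruct ea, eb, eu, ev; reflexivity. Qed.

Lemma pk_inj (D : DblData) (X Y Z W : ob D) (a : hom X Y) (b : hom Z W)
  (u : ver X Z) (v : ver Y W) (s s' : sq a b u v) : <[s]> = <[s']> -> s = s'.
Proof. intros H. dependent destruction H. reflexivity. Qed.

Lemma pk_JMeq (D : DblData) (X Y Z W : ob D) (a a' : hom X Y) (b b' : hom Z W)
  (u u' : ver X Z) (v v' : ver Y W) (s : sq a b u v) (s' : sq a' b' u' v') :
  <[s]> = <[s']> -> JMeq s s'.
Proof. intros H. dependent destruction H. reflexivity. Qed.

(** Heterogeneous equality of squares gives only an equality of their types, from which the
    boundaries cannot be read off; hence the explicit equations. *)
Lemma JMeq_pk (D : DblData) (X Y Z W : ob D) (a a' : hom X Y) (b b' : hom Z W)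
  (u u' : ver X Z) (v v' : ver Y W) (s : sq a b u v) (s' : sq a' b' u' v') :
  JMeq s s' -> a = a' -> b = b' -> u = u' -> v = v' -> <[s]> = <[s']>.
Proof. intros H -> -> -> ->. apply JMeq_eq in H. subst; reflexivity. Qed.

Definition ty (D : DblData) (X Y Z W : ob D) (p : psq D) (a : hom X Y) (b : hom Z W)
  (u : ver X Z) (v : ver Y W) : Prop := exists s : sq a b u v, p = <[s]>.

Lemma ty_pk (D : DblData) (X Y Z W : ob D) (a : hom X Y) (b : hom Z W)
  (u : ver X Z) (v : ver Y W) (s : sq a b u v) : ty <[s]> a b u v.
Proof. exists s; reflexivity. Qed.

Lemma ty_conv (D : DblData) (X Y Z W : ob D) (p : psq D) (a a' : hom X Y) (b b' : hom Z W)
  (u u' : ver X Z) (v v' : ver Y W) :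
  ty p a b u v -> a = a' -> b = b' -> u = u' -> v = v' -> ty p a' b' u' v'.
Proof. intros H -> -> -> ->; exact H. Qed.

(** The middle boundaries are compared propositionally, so that outer boundaries are inferred by
    unification and [v = v'] is left to rewriting. *)
Lemma ty_h (D : DblData) (X0 X1 X2 Y0 Y1 Y2 : ob D) (p q : psq D) (a : hom X0 X1)
    (a' : hom X1 X2) (b : hom Y0 Y1) (b' : hom Y1 Y2) (u : ver X0 Y0) (v v' : ver X1 Y1)
    (w : ver X2 Y2) :
  ty p a b u v -> ty q a' b' v' w -> v = v' -> ty (p ** q) (hcmp a' a) (hcmp b' b) u w.
Proof.
  intros [s ->] [t ->] <-. rewrite <- pk_h. apply ty_pk.
Qed.

Lemma ty_v (D : DblData) (X0 X1 Y0 Y1 Z0 Z1 : ob D) (p q : psq D)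
    (a : hom X0 X1) (b b' : hom Y0 Y1) (c : hom Z0 Z1)
    (u : ver X0 Y0) (v : ver X1 Y1) (u' : ver Y0 Z0) (v' : ver Y1 Z1) :
  ty p a b u v -> ty q b' c u' v' -> b = b' -> ty (p // q) a c (vcmp u' u) (vcmp v' v).
Proof.
  intros [s ->] [t ->] <-. rewrite <- pk_v. apply ty_pk.
Qed.

Definition hcomposable (D : DblData) (p q : psq D) : Prop := exists r, hrel p q r.
Definition vcomposable (D : DblData) (p q : psq D) : Prop := exists r, vrel p q r.

Lemma hc_undef (D : DblData) (p q : psq D) : ~ hcomposable p q -> p ** q = Undef.
Proof. intros H. apply pchoose_undef. intros r Hr; apply H; exists r; exact Hr. Qed.

Lemma vc_undef (D : DblData) (p q : psq D) : ~ vcomposable p q -> p // q = Undef.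
Proof. intros H. apply pchoose_undef. intros r Hr; apply H; exists r; exact Hr. Qed.

Section Boundaries.
Context (D : DblCat).

Lemma hA (W X Y Z : ob D) (a : hom W X) (b : hom X Y) (c : hom Y Z) :
  hcmp c (hcmp b a) = hcmp (hcmp c b) a.
Proof. apply (hcmpA (dax D)). Qed.

Lemma h1l (X Y : ob D) (a : hom X Y) : hcmp (hid Y) a = a.
Proof. apply (hcmp1l (dax D)). Qed.

Lemma h1r (X Y : ob D) (a : hom X Y) : hcmp a (hid X) = a.
Proof. apply (hcmp1r (dax D)). Qed.

Lemma vA (W X Y Z : ob D) (u : ver W X) (v : ver X Y) (w : ver Y Z) :
  vcmp w (vcmp v u) = vcmp (vcmp w v) u.
Proof. apply (vcmpA (dax D)). Qed.

Lemma v1l (X Y : ob D) (u : ver X Y) : vcmp (vid Y) u = u.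
Proof. apply (vcmp1l (dax D)). Qed.

Lemma v1r (X Y : ob D) (u : ver X Y) : vcmp u (vid X) = u.
Proof. apply (vcmp1r (dax D)). Qed.

End Boundaries.

Section FunctorBoundaries.
Context (A B : DblCat) (F : DFun A B).

Lemma Fh_cmp (X Y Z : ob A) (a : hom X Y) (b : hom Y Z) :
  fh F (hcmp b a) = hcmp (fh F b) (fh F a).
Proof. apply (fh_cmp (fax F)). Qed.

Lemma Fh_id (X : ob A) : fh F (hid X) = hid (fo F X).
Proof. apply (fh_id (fax F)). Qed.

Lemma Fv_cmp (X Y Z : ob A) (u : ver X Y) (v : ver Y Z) :
  fv F (vcmp v u) = vcmp (fv F v) (fv F u).
Proof. apply (fv_cmp (fax F)). Qed.

Lemma Fv_id (X : ob A) : fv F (vid X) = vid (fo F X).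
Proof. apply (fv_id (fax F)). Qed.

End FunctorBoundaries.

Hint Rewrite h1l h1r hA v1l v1r vA Fh_cmp Fh_id Fv_cmp Fv_id : dbl.

Ltac bdry := solve [reflexivity | autorewrite with dbl; reflexivity].

Ltac ty :=
  lazymatch goal with
  | |- ty (_ ** _) _ _ _ _ => eapply ty_h; [ty | ty | bdry]
  | |- ty (_ // _) _ _ _ _ => eapply ty_v; [ty | ty | bdry]
  | |- ty (Pk _) _ _ _ _ => apply ty_pk
  | |- _ => eassumption
  end.

(** * The double category axioms for packed squares *)

Section PackedLaws.
Context (D : DblCat).

(** A defined composite [p ** q] has the right boundary of [q], so it meets [r] exactly when [q]
    does, and symmetrically on the other side. Hence one undefined inner composite makes both sides
    [Undef]. *)
Lemma hcA (p q r : psq D) : p ** (q ** r) = p ** q ** r.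
Proof.
  destruct (excluded_middle_informative (hcomposable p q)) as [ [x Hx]|n].
  - destruct (excluded_middle_informative (hcomposable q r)) as [ [y Hy]|n].
    + destruct Hx. dependent destruction Hy.
      rewrite <- !pk_h. apply JMeq_pk; [apply (sqhA (dax D)) | bdry ..].
    + rewrite (hc_undef n), !hc_undef; auto.
      * intros [y Hy]. apply n. destruct Hx. rewrite <- pk_h in Hy.
        dependent destruction Hy. eexists; constructor.
      * intros [y Hy]. inversion Hy.
  - rewrite (hc_undef n), !hc_undef; auto.
    + intros [y Hy]. inversion Hy.
    + intros [y Hy]. apply n.
      destruct (excluded_middle_informative (hcomposable q r)) as [ [z Hz]|n'].
      * destruct Hz. rewrite <- pk_h in Hy. dependent destruction Hy. eexists; constructor.
      * rewrite (hc_undef n') in Hy. inversion Hy.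
Qed.

Lemma vcA (p q r : psq D) : p // (q // r) = p // q // r.
Proof.
  destruct (excluded_middle_informative (vcomposable p q)) as [ [x Hx]|n].
  - destruct (excluded_middle_informative (vcomposable q r)) as [ [y Hy]|n].
    + destruct Hx. dependent destruction Hy.
      rewrite <- !pk_v. apply JMeq_pk; [apply (sqvA (dax D)) | bdry ..].
    + rewrite (vc_undef n), !vc_undef; auto.
      * intros [y Hy]. apply n. destruct Hx. rewrite <- pk_v in Hy.
        dependent destruction Hy. eexists; constructor.
      * intros [y Hy]. inversion Hy.
  - rewrite (vc_undef n), !vc_undef; auto.
    + intros [y Hy]. inversion Hy.
    + intros [y Hy]. apply n.
      destruct (excluded_middle_informative (vcomposable q r)) as [ [z Hz]|n'].
      * destruct Hz. rewrite <- pk_v in Hy. dependent destruction Hy. eexists; constructor.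
      * rewrite (vc_undef n') in Hy. inversion Hy.
Qed.

Lemma hc1l (X Y Z W : ob D) (p : psq D) (a : hom X Y) (b : hom Z W) (u u' : ver X Z)
  (v : ver Y W) : ty p a b u v -> u = u' -> <[sqh1 u']> ** p = p.
Proof.
  intros [s ->] <-. rewrite <- pk_h.
  apply JMeq_pk; [apply (sqh1l (dax D)) | bdry ..].
Qed.

Lemma hc1r (X Y Z W : ob D) (p : psq D) (a : hom X Y) (b : hom Z W) (u : ver X Z)
  (v v' : ver Y W) : ty p a b u v -> v = v' -> p ** <[sqh1 v']> = p.
Proof.
  intros [s ->] <-. rewrite <- pk_h.
  apply JMeq_pk; [apply (sqh1r (dax D)) | bdry ..].
Qed.

Lemma vc1l (X Y Z W : ob D) (p : psq D) (a a' : hom X Y) (b : hom Z W) (u : ver X Z)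
  (v : ver Y W) : ty p a b u v -> a = a' -> <[sqv1 a']> // p = p.
Proof.
  intros [s ->] <-. rewrite <- pk_v.
  apply JMeq_pk; [apply (sqv1l (dax D)) | bdry ..].
Qed.

Lemma vc1r (X Y Z W : ob D) (p : psq D) (a : hom X Y) (b b' : hom Z W) (u : ver X Z)
  (v : ver Y W) : ty p a b u v -> b = b' -> p // <[sqv1 b']> = p.
Proof.
  intros [s ->] <-. rewrite <- pk_v.
  apply JMeq_pk; [apply (sqv1r (dax D)) | bdry ..].
Qed.

Lemma pk_v1_hcmp (X Y Z : ob D) (a : hom X Y) (b : hom Y Z) :
  <[sqv1 (hcmp b a)]> = <[sqv1 a]> ** <[sqv1 b]>.
Proof. rewrite (sqv1_hcmp (dax D)). apply pk_h. Qed.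

Lemma pk_h1_vcmp (X Y Z : ob D) (u : ver X Y) (v : ver Y Z) :
  <[sqh1 (vcmp v u)]> = <[sqh1 u]> // <[sqh1 v]>.
Proof. rewrite (sqh1_vcmp (dax D)). apply pk_v. Qed.

Lemma pk_h1_vid (X : ob D) : <[sqh1 (vid X)]> = <[sqv1 (hid X)]>.
Proof. rewrite (sqh1_vid (dax D)). reflexivity. Qed.

(** Unlike associativity, interchange needs the boundaries: [p // r] and [q // s] may meet along a
    composite vertical morphism although [p] and [q] do not meet. *)
Lemma vc_hc (X0 X1 X2 Y0 Y1 Y2 Z0 Z1 Z2 : ob D) (p q r s : psq D)
      (a : hom X0 X1) (a' : hom X1 X2) (b b1 : hom Y0 Y1) (b' b1' : hom Y1 Y2)
      (c : hom Z0 Z1) (c' : hom Z1 Z2)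
      (u : ver X0 Y0) (v v1 : ver X1 Y1) (w : ver X2 Y2)
      (u' : ver Y0 Z0) (v' v1' : ver Y1 Z1) (w' : ver Y2 Z2) :
  ty p a b u v -> ty q a' b' v1 w -> ty r b1 c u' v' -> ty s b1' c' v1' w' ->
  v = v1 -> v' = v1' -> b = b1 -> b' = b1' ->
  (p ** q) // (r ** s) = (p // r) ** (q // s).
Proof.
  intros [? ->] [? ->] [? ->] [? ->] <- <- <- <-.
  rewrite <- !pk_h, <- !pk_v, <- pk_h. f_equal. apply (interchange (dax D)).
Qed.

End PackedLaws.

(** * Whiskering with weakly horizontally invertible squares *)

Ltac pk := repeat first [rewrite pk_h | rewrite pk_v | rewrite pk_cast].
Ltac exch p q r s :=
  rewrite (@vc_hc _ _ _ _ _ _ _ _ _ _ p q r s _ _ _ _ _ _ _ _ _ _ _ _ _ _ _ _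
    ltac:(ty) ltac:(ty) ltac:(ty) ltac:(ty) ltac:(bdry) ltac:(bdry) ltac:(bdry) ltac:(bdry)).
Ltac exchr p q r s :=
  rewrite <- (@vc_hc _ _ _ _ _ _ _ _ _ _ p q r s _ _ _ _ _ _ _ _ _ _ _ _ _ _ _ _
    ltac:(ty) ltac:(ty) ltac:(ty) ltac:(ty) ltac:(bdry) ltac:(bdry) ltac:(bdry) ltac:(bdry)).

Section Whiskering.
Context (D : DblCat).

(** The assumption says that [s0] and [s1] form a 2-cell from [m] to the identity of [v] in the
    2-category of vertical morphisms. Inserting that identity next to [ga] and interchanging moves
    the cell across, so [ga ** m] determines [ga] once the cell is invertible. *)
Lemma retract_formula (Z Z' X X' : ob D) (f : hom Z X) (g : hom Z' X') (x : ver Z Z')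
  (v : ver X X') (i : hom X X) (j : hom X' X') (ga : sq f g x v) (m : sq i j v v)
  (s0 : sq i (hid X) (vid X) (vid X)) (s1 : sq j (hid X') (vid X') (vid X')) :
  <[s0]> // <[sqh1 v]> = <[m]> // <[s1]> ->
  (<[sqv1 f]> ** <[s0]>) // <[ga]> = (<[ga]> ** <[m]>) // (<[sqv1 g]> ** <[s1]>).
Proof.
  intros E.
  rewrite <- (hc1r (ty_pk ga) eq_refl) at 1.
  exch <[sqv1 f]> <[s0]> <[ga]> <[sqh1 v]>.
  exch <[ga]> <[m]> <[sqv1 g]> <[s1]>.
  rewrite E, (vc1l (ty_pk ga)), (vc1r (ty_pk ga)) by reflexivity.
  reflexivity.
Qed.

Lemma vinvE (X Y : ob D) (a b : hom X Y) (s : sq a b (vid X) (vid Y)) :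
  vinv s <-> exists t : sq b a (vid X) (vid Y),
    <[s]> // <[t]> = <[sqv1 a]> /\ <[t]> // <[s]> = <[sqv1 b]>.
Proof.
  split; intros [t [H1 H2]]; exists t; split;
    first [ rewrite <- pk_v; apply JMeq_pk; [assumption | bdry ..]
          | apply pk_JMeq; rewrite pk_v; assumption ].
Qed.

Lemma va_isoE (X Y X' Y' : ob D) (u : ver X X') (v : ver Y Y')
  (a c : hom X Y) (b d : hom X' Y') (al : sq a b u v) (be : sq c d u v) :
  va_iso al be <->
  exists (s0 : sq a c (vid X) (vid Y)) (s1 : sq b d (vid X') (vid Y'))
         (t0 : sq c a (vid X) (vid Y)) (t1 : sq d b (vid X') (vid Y')),
    <[s0]> // <[be]> = <[al]> // <[s1]> /\ <[t0]> // <[al]> = <[be]> // <[t1]> /\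
    <[s0]> // <[t0]> = <[sqv1 a]> /\ <[t0]> // <[s0]> = <[sqv1 c]> /\
    <[s1]> // <[t1]> = <[sqv1 b]> /\ <[t1]> // <[s1]> = <[sqv1 d]>.
Proof.
  split; intros (s0 & s1 & t0 & t1 & H1 & H2 & H3 & H4 & H5 & H6);
    exists s0, s1, t0, t1; repeat split;
    first [ rewrite <- ?pk_v; apply JMeq_pk; [assumption | bdry ..]
          | apply pk_JMeq; rewrite ?pk_v; assumption ].
Qed.

Lemma vcancel_r (X Y Z W : ob D) (a : hom X Y) (b c : hom Z W) (u : ver X Z)
  (v : ver Y W) (a' : hom X Y) (c' : hom Z W) (u' : ver X Z) (v' : ver Y W) p p' q q' :
  q // q' = <[sqv1 b]> -> ty p a c u v -> ty p' a' c' u' v' -> c = b -> c' = b ->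
  p // q = p' // q -> p = p'.
Proof.
  intros K T T' H H' E.
  apply (f_equal (fun x => x // q')) in E. rewrite <- !vcA, K in E.
  rewrite (vc1r T H), (vc1r T' H') in E. exact E.
Qed.

Lemma vcancel_l (X Y Z W : ob D) (a b : hom X Y) (c : hom Z W) (u : ver X Z)
  (v : ver Y W) (a' : hom X Y) (c' : hom Z W) (u' : ver X Z) (v' : ver Y W) p p' q q' :
  q' // q = <[sqv1 b]> -> ty p a c u v -> ty p' a' c' u' v' -> a = b -> a' = b ->
  q // p = q // p' -> p = p'.
Proof.
  intros K T T' H H' E.
  apply (f_equal (fun x => q' // x)) in E. rewrite !vcA, K in E.
  rewrite (vc1l T H), (vc1l T' H') in E. exact E.
Qed.

(* No triangle identity is needed: faithfulness of whiskering by [al] comes from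
   [al ** be ~ id], and its fullness from faithfulness of whiskering by the inverse [be]. *)
Lemma whisker_faithful (X Y X' Y' : ob D) (v : ver X X') (w : ver Y Y')
  (a : hom X Y) (b : hom X' Y') (al : sq a b v w) :
  wh_inv al ->
  forall (Z Z' : ob D) (f : hom Z X) (g : hom Z' X') (x : ver Z Z') (ga ga' : sq f g x v),
    <[ga]> ** <[al]> = <[ga']> ** <[al]> -> ga = ga'.
Proof.
  intros (c & d & be & H & _) Z Z' f g x ga ga' E.
  apply va_isoE in H. destruct H as (s0 & s1 & t0 & t1 & H1 & _ & _ & H4 & _).
  pose proof (retract_formula ga H1) as E1.
  pose proof (retract_formula ga' H1) as E2.
  rewrite pk_h, hcA in E1, E2. rewrite E, <- E2 in E1.
  apply (f_equal (fun p => (<[sqv1 f]> ** <[t0]>) // p)) in E1.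
  rewrite !vcA in E1.
  assert (K : (<[sqv1 f]> ** <[t0]>) // (<[sqv1 f]> ** <[s0]>) = <[sqv1 f]>).
  { exch <[sqv1 f]> <[t0]> <[sqv1 f]> <[s0]>.
    rewrite H4, <- pk_h1_vid, (vc1l (ty_pk (sqv1 f))) by reflexivity.
    apply (hc1r (ty_pk _)). reflexivity. }
  rewrite K, (vc1l (ty_pk ga)), (vc1l (ty_pk ga')) in E1 by reflexivity.
  apply pk_inj; exact E1.
Qed.

Lemma whisker_full (X Y X' Y' : ob D) (v : ver X X') (w : ver Y Y')
  (a : hom X Y) (b : hom X' Y') (al : sq a b v w) :
  wh_inv al ->
  forall (Z Z' : ob D) (f : hom Z X) (g : hom Z' X') (x : ver Z Z')
    (si : sq (hcmp a f) (hcmp b g) x w),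
    exists ga : sq f g x v, <[ga]> ** <[al]> = <[si]>.
Proof.
  intros (c & d & be & H & H') Z Z' f g x si.
  assert (Wbe : wh_inv be) by (exists a, b, al; split; assumption).
  apply va_isoE in H. destruct H as (s0 & s1 & t0 & t1 & H1 & _ & H3 & H4 & H5 & H6).
  (* The retract formula solved for [ga], with [si] in place of [ga ** al]. *)
  assert (T : ty ((<[sqv1 f]> ** <[t0]>) // (<[si]> ** <[be]>) // (<[sqv1 g]> ** <[s1]>))
                f g x v).
  { eapply ty_conv; [ty | bdry ..]. }
  destruct T as [ga Hga]. exists ga.
  assert (T : ty (<[ga]> ** <[al]>) (hcmp a f) (hcmp b g) x w) by ty.
  destruct T as [si' Hsi]. rewrite Hsi. f_equal.
  (* It remains to compare [ga ** al] with [si]. After whiskering with [be] the retract formula for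
     [ga] does this, up to the invertible [s1] at the bottom, which [K] cancels. *)
  apply (whisker_faithful Wbe). rewrite <- Hsi, <- hcA, <- pk_h.
  assert (K : (<[sqv1 g]> ** <[s1]>) // (<[sqv1 g]> ** <[t1]>) = <[sqv1 (hcmp (hcmp d b) g)]>).
  { exch <[sqv1 g]> <[s1]> <[sqv1 g]> <[t1]>.
    rewrite H5, (vc1l (ty_pk (sqv1 g))) by reflexivity.
    symmetry; apply pk_v1_hcmp. }
  assert (K' : (<[sqv1 f]> ** <[s0]>) // (<[sqv1 f]> ** <[t0]>) = <[sqv1 (hcmp (hcmp c a) f)]>).
  { exch <[sqv1 f]> <[s0]> <[sqv1 f]> <[t0]>.
    rewrite H3, (vc1l (ty_pk (sqv1 f))) by reflexivity.
    symmetry; apply pk_v1_hcmp. }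
  eapply vcancel_r; [exact K | ty | ty | bdry | bdry |].
  rewrite <- (retract_formula ga H1), <- Hga, !vcA, K'.
  f_equal. eapply vc1l; [ty | bdry].
Qed.

Lemma whisker_full_ty (X Y X' Y' : ob D) (v : ver X X') (w : ver Y Y')
  (a : hom X Y) (b : hom X' Y') (al : sq a b v w) :
  wh_inv al ->
  forall (Z Z' : ob D) (f : hom Z X) (g : hom Z' X') (x : ver Z Z') p,
    ty p (hcmp a f) (hcmp b g) x w ->
    exists ga : sq f g x v, <[ga]> ** <[al]> = p.
Proof. intros H Z Z' f g x p [si ->]. apply whisker_full; assumption. Qed.

Lemma wh_inv_sqh1 (X X' : ob D) (u : ver X X') : wh_inv (sqh1 u).
Proof.
  exists (hid X), (hid X'), (sqh1 u).
  assert (H : va_iso (sqh (sqh1 u) (sqh1 u)) (sqh1 u)); [|split; exact H].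
  apply va_isoE. rewrite !pk_h, (hc1r (ty_pk (sqh1 u)) eq_refl).
  exists (sqcast eq_refl (h1l (hid X)) eq_refl eq_refl (sqv1 _)),
    (sqcast eq_refl (h1l (hid X')) eq_refl eq_refl (sqv1 _)),
    (sqcast (h1l (hid X)) eq_refl eq_refl eq_refl (sqv1 _)),
    (sqcast (h1l (hid X')) eq_refl eq_refl eq_refl (sqv1 _)).
  rewrite !pk_cast, !h1l.
  repeat split; try (erewrite vc1l; [reflexivity | ty | bdry]);
   (rewrite (vc1l (ty_pk (sqh1 u))), (vc1r (ty_pk (sqh1 u))) by reflexivity; reflexivity).
Qed.

Lemma wh_inv_sqv1 (X Y : ob D) (f : hom X Y) : hequiv f -> wh_inv (sqv1 f).
Proof.
  intros (g & s & t & Hs & Ht).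
  apply vinvE in Hs. destruct Hs as (s' & Hs1 & Hs2).
  apply vinvE in Ht. destruct Ht as (t' & Ht1 & Ht2).
  exists g, g, (sqv1 g). split; apply va_isoE.
  - exists s, s, s', s'. rewrite pk_h, <- pk_v1_hcmp, pk_h1_vid.
    repeat split; auto.
    + rewrite (vc1l (ty_pk s)), (vc1r (ty_pk s)) by reflexivity; reflexivity.
    + rewrite (vc1l (ty_pk s')), (vc1r (ty_pk s')) by reflexivity; reflexivity.
  - exists t, t, t', t'. rewrite pk_h, <- pk_v1_hcmp, pk_h1_vid.
    repeat split; auto.
    + rewrite (vc1l (ty_pk t)), (vc1r (ty_pk t)) by reflexivity; reflexivity.
    + rewrite (vc1l (ty_pk t')), (vc1r (ty_pk t')) by reflexivity; reflexivity.
Qed.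

(** A 2-cell of the 2-category of vertical morphisms is a pair of horizontal 2-cells, so equivalence
    data restrict to the tops and to the bottoms. *)
Lemma wh_inv_hequiv (X Y X' Y' : ob D) (u : ver X X') (v : ver Y Y')
  (a : hom X Y) (b : hom X' Y') (al : sq a b u v) :
  wh_inv al -> hequiv a /\ hequiv b.
Proof.
  intros (c & d & be & H & H').
  apply va_isoE in H. destruct H as (s0 & s1 & t0 & t1 & _ & _ & H).
  apply va_isoE in H'. destruct H' as (s0' & s1' & t0' & t1' & _ & _ & H').
  split; [exists c, s0, s0' | exists d, s1, s1']; split; apply vinvE; eexists;
    intuition eassumption.
Qed.

Definition hiso (X Y : ob D) (a b : hom X Y) : Prop :=
  exists s : sq a b (vid X) (vid Y), vinv s.

Lemma hiso_refl (X Y : ob D) (a : hom X Y) : hiso a a.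
Proof.
  exists (sqv1 a). apply vinvE. exists (sqv1 a).
  rewrite (vc1l (ty_pk (sqv1 a))) by reflexivity. auto.
Qed.

Lemma hiso_sym (X Y : ob D) (a b : hom X Y) : hiso a b -> hiso b a.
Proof.
  intros [s H]. apply vinvE in H. destruct H as (t & H1 & H2).
  exists t. apply vinvE. exists s. auto.
Qed.

(** A form of [vinv] in which the boundaries are parameters only, so that they can be rewritten
    without a cast. *)
Definition pinv (p : psq D) (X Y : ob D) (a b : hom X Y) : Prop :=
  ty p a b (vid X) (vid Y) /\
  exists q, ty q b a (vid X) (vid Y) /\ p // q = <[sqv1 a]> /\ q // p = <[sqv1 b]>.

Lemma pinv_vinv (X Y : ob D) (a b : hom X Y) (s : sq a b (vid X) (vid Y)) :
  pinv <[s]> a b <-> vinv s.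
Proof.
  rewrite vinvE. split.
  - intros (_ & q & (t & ->) & H1 & H2). exists t; auto.
  - intros (t & H1 & H2). split; [ty|]. exists <[t]>. split; [ty | auto].
Qed.

Lemma pinv_v (X Y : ob D) (a b b' c : hom X Y) p q :
  pinv p a b -> pinv q b' c -> b = b' -> pinv (p // q) a c.
Proof.
  intros (Tp & p' & Tp' & P1 & P2) (Tq & q' & Tq' & Q1 & Q2) <-.
  split; [eapply ty_conv; [ty | bdry ..]|].
  exists (q' // p'). split; [eapply ty_conv; [ty | bdry ..]|]. split.
  - rewrite vcA, <- (vcA p), Q1, (vc1r Tp) by reflexivity. exact P1.
  - rewrite vcA, <- (vcA q'), P2, (vc1r Tq') by reflexivity. exact Q2.
Qed.

Lemma pinv_h (X Y Z : ob D) (a b : hom X Y) (a' b' : hom Y Z) p q :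
  pinv p a b -> pinv q a' b' -> pinv (p ** q) (hcmp a' a) (hcmp b' b).
Proof.
  intros (Tp & p' & Tp' & P1 & P2) (Tq & q' & Tq' & Q1 & Q2).
  split; [ty|]. exists (p' ** q'). split; [ty|]. split.
  - exch p q p' q'. rewrite P1, Q1. symmetry; apply pk_v1_hcmp.
  - exch p' q' p q. rewrite P2, Q2. symmetry; apply pk_v1_hcmp.
Qed.

Lemma pinv_1 (X Y : ob D) (a : hom X Y) : pinv <[sqv1 a]> a a.
Proof.
  split; [ty|]. exists <[sqv1 a]>. split; [ty|].
  rewrite (vc1l (ty_pk (sqv1 a))) by reflexivity. auto.
Qed.

Lemma pinv_conv (X Y : ob D) (a b a' b' : hom X Y) p :
  pinv p a b -> a = a' -> b = b' -> pinv p a' b'.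
Proof. intros H -> ->; exact H. Qed.

Lemma hisoE (X Y : ob D) (a b : hom X Y) : hiso a b <-> exists p, pinv p a b.
Proof.
  split.
  - intros [s H]. exists <[s]>. apply pinv_vinv; exact H.
  - intros [p H]. assert (H' := H). destruct H as [[s ->] _].
    exists s. apply pinv_vinv; exact H'.
Qed.

Lemma hiso_trans (X Y : ob D) (a b c : hom X Y) : hiso a b -> hiso b c -> hiso a c.
Proof.
  rewrite !hisoE. intros [p Hp] [q Hq]. exists (p // q).
  eapply pinv_v; eauto.
Qed.

Lemma hiso_hcmp (X Y Z : ob D) (a b : hom X Y) (a' b' : hom Y Z) :
  hiso a b -> hiso a' b' -> hiso (hcmp a' a) (hcmp b' b).
Proof.
  rewrite !hisoE. intros [p Hp] [q Hq]. exists (p ** q).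
  apply pinv_h; assumption.
Qed.

End Whiskering.

(* Rewriting horizontal morphisms up to isomorphism *)
Add Parametric Relation (D : DblCat) (X Y : ob D) : (hom X Y) (@hiso D X Y)
  reflexivity proved by (@hiso_refl D X Y)
  symmetry proved by (@hiso_sym D X Y)
  transitivity proved by (@hiso_trans D X Y)
  as hiso_rel.

Add Parametric Morphism (D : DblCat) (X Y Z : ob D) : (@hcmp D X Y Z)
  with signature (@hiso D Y Z) ==> (@hiso D X Y) ==> (@hiso D X Z) as hcmp_hiso_mor.
Proof. intros. apply hiso_hcmp; assumption. Qed.

Section HIso.
Context (D : DblCat).

Lemma hequivE (X Y : ob D) (f : hom X Y) :
  hequiv f <-> exists g : hom Y X, hiso (hcmp g f) (hid X) /\ hiso (hcmp f g) (hid Y).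
Proof.
  split.
  - intros (g & s & t & Hs & Ht). exists g. split; [exists s | exists t]; assumption.
  - intros (g & [s Hs] & [t Ht]). exists g, s, t. auto.
Qed.

Lemma hequiv_cancel_r (X Y Z : ob D) (e : hom X Y) (a b : hom Y Z) :
  hequiv e -> hiso (hcmp a e) (hcmp b e) -> hiso a b.
Proof.
  rewrite hequivE. intros (g & _ & H) E.
  rewrite <- (h1r a), <- (h1r b), <- H, !hA, E. reflexivity.
Qed.

Lemma hequiv_hid (X : ob D) : hequiv (hid X).
Proof. apply hequivE. exists (hid X). rewrite h1l. split; reflexivity. Qed.

Lemma hequiv_lift (W Y Z : ob D) (e : hom Y Z) (b : hom W Z) :
  hequiv e -> exists c : hom W Y, hiso b (hcmp e c).
Proof.
  rewrite hequivE. intros (g & _ & H). exists (hcmp g b).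
  rewrite hA, H, h1l. reflexivity.
Qed.

End HIso.

(** * From a pseudo inverse to a double biequivalence *)

(** The horizontal opposite, which turns statements on right whiskering into statements on left
    whiskering. *)
Definition hop_data (D : DblData) : DblData := {|
  ob := ob D;
  hom := fun X Y => @hom D Y X;
  ver := fun X Y => @ver D X Y;
  sq := fun X Y Z W a b u v => @sq D Y X W Z a b v u;
  hid := fun X => hid X;
  hcmp := fun X Y Z b a => hcmp a b;
  vid := fun X => vid X;
  vcmp := fun X Y Z v u => vcmp v u;
  sqh1 := fun X Y u => sqh1 u;
  sqv1 := fun X Y a => sqv1 a;
  sqh := fun A B E C D F a a' b b' u v w s t => sqh t s;
  sqv := fun A B C D E F a b c u v u' v' s t => sqv s t
|}.

Lemma hop_ax (D : DblCat) : IsDblCat (hop_data D).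
Proof.
  destruct D as [D [ ]]; simpl; split; simpl; intros; first [solve [auto] | symmetry; auto].
Qed.

Definition hop (D : DblCat) : DblCat := MkDblCat (hop_ax D).

Section Functor.
Context (A B : DblCat) (F : DFun A B).

Lemma pk_fh (X0 X1 X2 Y0 Y1 Y2 : ob A) (a : hom X0 X1) (a' : hom X1 X2)
    (b : hom Y0 Y1) (b' : hom Y1 Y2) (u : ver X0 Y0) (v : ver X1 Y1) (w : ver X2 Y2)
    (s : sq a b u v) (t : sq a' b' v w) :
  <[fs F (sqh s t)]> = <[fs F s]> ** <[fs F t]>.
Proof. rewrite <- pk_h. apply JMeq_pk; [apply (fs_h (fax F)) | bdry ..]. Qed.

Lemma pk_fv (X0 X1 Y0 Y1 Z0 Z1 : ob A) (a : hom X0 X1) (b : hom Y0 Y1) (c : hom Z0 Z1)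
    (u : ver X0 Y0) (v : ver X1 Y1) (u' : ver Y0 Z0) (v' : ver Y1 Z1)
    (s : sq a b u v) (t : sq b c u' v') :
  <[fs F (sqv s t)]> = <[fs F s]> // <[fs F t]>.
Proof. rewrite <- pk_v. apply JMeq_pk; [apply (fs_v (fax F)) | bdry ..]. Qed.

Lemma pk_fh1 (X Y : ob A) (u : ver X Y) : <[fs F (sqh1 u)]> = <[sqh1 (fv F u)]>.
Proof. apply JMeq_pk; [apply (fs_h1 (fax F)) | bdry ..]. Qed.

Lemma pk_fv1 (X Y : ob A) (a : hom X Y) : <[fs F (sqv1 a)]> = <[sqv1 (fh F a)]>.
Proof. apply JMeq_pk; [apply (fs_v1 (fax F)) | bdry ..]. Qed.

Lemma pk_fs (X Y Z W : ob A) (a a' : hom X Y) (b b' : hom Z W)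
  (u u' : ver X Z) (v v' : ver Y W) (s : sq a b u v) (s' : sq a' b' u' v') :
  <[s]> = <[s']> -> <[fs F s]> = <[fs F s']>.
Proof. intros H. dependent destruction H. reflexivity. Qed.

Lemma hiso_fh (X Y : ob A) (a b : hom X Y) : hiso a b -> hiso (fh F a) (fh F b).
Proof.
  intros [s Hs]. apply vinvE in Hs. destruct Hs as (t & H1 & H2).
  rewrite <- pk_v in H1, H2. apply pk_fs in H1, H2.
  rewrite pk_fv, pk_fv1 in H1, H2.
  apply hisoE. exists <[fs F s]>. split; [eapply ty_conv; [ty | bdry ..]|].
  exists <[fs F t]>. split; [eapply ty_conv; [ty | bdry ..]|]. auto.
Qed.

End Functor.

Section Converse.

Lemma whisker_faithful_l (D : DblCat) (X Y X' Y' : ob D) (v : ver X X') (w : ver Y Y')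
  (a : hom X Y) (b : hom X' Y') (al : sq a b v w) :
  wh_inv al ->
  forall (Z Z' : ob D) (f : hom Y Z) (g : hom Y' Z') (x : ver Z Z') (ga ga' : sq f g w x),
    sqh al ga = sqh al ga' -> ga = ga'.
Proof.
  intros (c & d & be & H & H') Z Z' f g x ga ga' E.
  refine (@whisker_faithful (hop D) Y X Y' X' w v a b al _ Z Z' f g x ga ga' _).
  - exists c, d, be. split; [exact H' | exact H].
  - rewrite <- !pk_h. simpl. f_equal. exact E.
Qed.

Lemma hequiv_inverse (D : DblCat) (X Y : ob D) (f : hom X Y) :
  hequiv f -> exists g : hom Y X, hequiv g.
Proof.
  intros (g & s & t & Hs & Ht). exists g, f, t, s. auto.
Qed.

Lemma th_pinv (A B : DblCat) (S T : HPFD A B) (h : HPNT S T) (X Y : ob A) (a : hom X Y) :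
  pinv <[th h a]> (hcmp (ph T a) (tc h X)) (hcmp (tc h Y) (ph S a)).
Proof. apply pinv_vinv. apply (th_vinv (tax h)). Qed.

Lemma t_nat_pk (A B : DblCat) (S T : HPFD A B) (h : HPNT S T) (X Y X' Y' : ob A)
  (a : hom X Y) (b : hom X' Y') (u : ver X X') (v : ver Y Y') (al : sq a b u v) :
  <[th h a]> // (<[ps S al]> ** <[tv h v]>) = (<[tv h u]> ** <[ps T al]>) // <[th h b]>.
Proof.
  rewrite <- !pk_h, <- !pk_v. apply JMeq_pk; try bdry. apply (t_nat (tax h)).
Qed.

(** Up to invertible squares, naturality identifies [ps S al] whiskered with [tv h v] and [ps T al]
    whiskered with [tv h u]. Both whiskerings are injective, so each square determines the other. *)
Lemma hpnt_equiv_faithful (A B : DblCat) (S T : HPFD A B) (h : HPNT S T) :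
  hpnt_equiv h ->
  forall (X Y X' Y' : ob A) (a : hom X Y) (b : hom X' Y') (u : ver X X') (v : ver Y Y')
    (al be : sq a b u v), (ps S al = ps S be <-> ps T al = ps T be).
Proof.
  intros [_ W] X Y X' Y' a b u v al be.
  destruct (th_pinv h a) as (Ta & qa & Tqa & Pa & Qa).
  destruct (th_pinv h b) as (Tb & qb & Tqb & Pb & Qb).
  pose proof (t_nat_pk h al) as N1. pose proof (t_nat_pk h be) as N2.
  split; intros E; rewrite E in N1.
  - rewrite N1 in N2. eapply vcancel_r in N2; [| exact Pb | ty | ty | bdry | bdry].
    symmetry. apply (whisker_faithful_l (W _ _ u)). apply pk_inj. rewrite !pk_h. auto.
  - rewrite <- N2 in N1. eapply vcancel_l in N1; [| exact Qa | ty | ty | bdry | bdry].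
    apply (whisker_faithful (W _ _ v)). auto.
Qed.

(** Inverses of the components of [eps] give (db1) and (db3). For (db2) and (db4) a preimage is
    found with [eta] and checked with [eps]. *)
Lemma double_biequiv_of_equivalence (A B : DblCat) (F : DFun A B) (G : HPF B A)
  (eta : HPNT (idD A) (compGF G F)) (eps : HPNT (compFG F G) (idD B)) :
  hpnt_equiv eta -> hpnt_equiv eps -> double_biequiv F.
Proof.
  intros Heta Heps. repeat split.
  - intros Y. exists (po G Y). destruct Heps as [E _].
    exact (hequiv_inverse (E Y)).
  - intros X Z b.
    (* The morphism [a] makes the naturality isomorphism of [eta] hold with [b] in place of
       [fh F a]. *)
    destruct (hequiv_lift (e := tc eta Z) (hcmp (ph G b) (tc eta X)) (proj1 Heta Z))
      as [a Ha]. simpl in a. exists a.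
    enough (H : hiso b (fh F a)) by exact H.
    assert (E1 : hiso (ph G b) (ph G (fh F a))).
    { apply (hequiv_cancel_r (proj1 Heta X)). rewrite Ha. symmetry.
      apply hisoE. eexists. exact (th_pinv eta a). }
    (* After applying [F], naturality of [eps] at [b] and at [fh F a] turns this into an isomorphism
       between these two. *)
    assert (E2 : hiso (fh F (ph G b)) (fh F (ph G (fh F a)))).
    { apply hiso_fh; exact E1. }
    apply (hequiv_cancel_r (proj1 Heps (fo F X))).
    transitivity (hcmp (tc eps (fo F Z)) (fh F (ph G b))).
    { apply hisoE. eexists. exact (th_pinv eps b). }
    rewrite E2. symmetry.
    apply hisoE. eexists. exact (th_pinv eps (fh F a)).
  - intros Y Y' v. exists (po G Y), (po G Y'), (pv G v).
    destruct Heps as [_ E]. destruct (E Y Y' v) as (c & d & be & H & H').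
    exists c, d, be, (tc eps Y), (tc eps Y'), (tv eps v). split; assumption.
  - intros X Z X' Z' a c u u' be.
    destruct (th_pinv eta a) as (Ta & qa & Tqa & Pa & Qa).
    destruct (th_pinv eta c) as (Tc & qc & Tqc & Pc & Qc).
    simpl in *.
    (* The naturality equation of [eta] solved for the whiskered square, with [be] in place of
       [fs F al]. *)
    destruct (whisker_full_ty (proj2 Heta _ _ u')
       (p := qa // (<[tv eta u]> ** <[ps G be]>) // <[th eta c]>)
       (f := a) (g := c) (x := u)) as [al Hal].
    { simpl. eapply ty_conv; [ty | bdry ..]. }
    assert (E1 : ps G (fs F al) = ps G be).
    { pose proof (t_nat_pk eta al) as N. simpl in N, Hal. rewrite Hal, !vcA, Pa in N.
      eapply vcancel_r in N; [| exact Pc | ty | ty | bdry | bdry].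
      apply (whisker_faithful_l (proj2 Heta _ _ u)). apply pk_inj. rewrite !pk_h.
      refine (eq_trans (eq_sym N) _).
      eapply vc1l; [ty | bdry]. }
    assert (E2 : fs F al = be).
    { apply (proj1 (hpnt_equiv_faithful Heps (fs F al) be)). exact (f_equal (fun s => fs F s) E1). }
    exists al. split; [exact E2|].
    (* Equal images under [F] have equal images under [GF], and [eta] makes [GF] faithful on
       squares. *)
    intros al' E. apply (proj2 (hpnt_equiv_faithful Heta al al')). exact (f_equal (fun s => ps G s) (eq_trans E2 (eq_sym E))).
Qed.
End Converse.

(** * The comma double category *)

Definition of_ty (D : DblData) (X Y Z W : ob D) (p : psq D) (a : hom X Y) (b : hom Z W)
  (u : ver X Z) (v : ver Y W) (H : ty p a b u v) : sq a b u v :=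
  proj1_sig (constructive_indefinite_description _ H).

Lemma pk_of_ty (D : DblData) (X Y Z W : ob D) (p : psq D) (a : hom X Y) (b : hom Z W)
  (u : ver X Z) (v : ver Y W) (H : ty p a b u v) : <[of_ty H]> = p.
Proof.
  unfold of_ty. destruct (constructive_indefinite_description _ H); simpl; auto.
Qed.

Section Whisker.
Context (D : DblCat).

Lemma vc_whisker_r (X Y Z : ob D) (a b b' c : hom X Y) (f : hom Y Z) p q :
  ty p a b (vid X) (vid Y) -> ty q b' c (vid X) (vid Y) -> b = b' ->
  (p // q) ** <[sqv1 f]> = (p ** <[sqv1 f]>) // (q ** <[sqv1 f]>).
Proof.
  intros Tp Tq <-. exch p <[sqv1 f]> q <[sqv1 f]>.
  rewrite (vc1l (ty_pk (sqv1 f))) by reflexivity. reflexivity.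
Qed.

Lemma vc_whisker_l (X Y Z : ob D) (a b b' c : hom Y Z) (f : hom X Y) p q :
  ty p a b (vid Y) (vid Z) -> ty q b' c (vid Y) (vid Z) -> b = b' ->
  <[sqv1 f]> ** (p // q) = (<[sqv1 f]> ** p) // (<[sqv1 f]> ** q).
Proof.
  intros Tp Tq <-. exch <[sqv1 f]> p <[sqv1 f]> q.
  rewrite (vc1l (ty_pk (sqv1 f))) by reflexivity. reflexivity.
Qed.

Lemma hc_id_l (X Y : ob D) (a b : hom X Y) p :
  ty p a b (vid X) (vid Y) -> <[sqv1 (hid X)]> ** p = p.
Proof. intros T. rewrite <- pk_h1_vid. apply (hc1l T); reflexivity. Qed.

Lemma hc_id_r (X Y : ob D) (a b : hom X Y) p :
  ty p a b (vid X) (vid Y) -> p ** <[sqv1 (hid Y)]> = p.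
Proof. intros T. rewrite <- pk_h1_vid. apply (hc1r T); reflexivity. Qed.

End Whisker.

Section Comma.
Context (A B : DblCat) (F : DFun A B).

(** The equivalence points the way the components of [epsilon] do; those from (db1) and (db3) point
    the other way and are inverted when the section is chosen. *)
Record cob := MkCob { cY : ob B; cX : ob A; ce : hom (fo F cX) cY; ce_equiv : hequiv ce }.

Record chom (p q : cob) := MkChom {
  hb : hom (cY p) (cY q);
  ha : hom (cX p) (cX q);
  hphi : sq (hcmp hb (ce p)) (hcmp (ce q) (fh F ha)) (vid (fo F (cX p))) (vid (cY q));
  hphi_inv : pinv <[hphi]> (hcmp hb (ce p)) (hcmp (ce q) (fh F ha)) }.

Record cver (p q : cob) := MkCver {
  vb : ver (cY p) (cY q);
  va : ver (cX p) (cX q);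
  vs : sq (ce p) (ce q) (fv F va) vb }.

(** The field [s_compat] has the shape of [t_nat] for a transformation with components [ce], [vs]
    and [hphi], so naturality of the counit is part of the data. *)
Record csq (p q r s : cob) (a : chom p q) (b : chom r s) (u : cver p r) (v : cver q s) :=
  MkCsq {
  sb : sq (hb a) (hb b) (vb u) (vb v);
  sa : sq (ha a) (ha b) (va u) (va v);
  s_compat : <[hphi a]> // (<[fs F sa]> ** <[vs v]>) = (<[vs u]> ** <[sb]>) // <[hphi b]> }.

Lemma chom_eq (p q : cob) (a b : chom p q) :
  hb a = hb b -> ha a = ha b -> <[hphi a]> = <[hphi b]> -> a = b.
Proof.
  destruct a as [b1 a1 f1 i1], b as [b2 a2 f2 i2]; simpl. intros <- <- H.
  apply pk_inj in H. subst. f_equal. apply proof_irrelevance.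
Qed.

Lemma cver_eq (p q : cob) (a b : cver p q) :
  vb a = vb b -> va a = va b -> <[vs a]> = <[vs b]> -> a = b.
Proof.
  destruct a as [b1 a1 f1], b as [b2 a2 f2]; simpl. intros <- <- H.
  apply pk_inj in H. subst. reflexivity.
Qed.

Lemma csq_eq (p q r s : cob) (a : chom p q) (b : chom r s) (u : cver p r) (v : cver q s)
  (x y : csq a b u v) : <[sb x]> = <[sb y]> -> <[sa x]> = <[sa y]> -> x = y.
Proof.
  destruct x as [b1 a1 i1], y as [b2 a2 i2]; simpl. intros H H'.
  apply pk_inj in H, H'. subst. f_equal. apply proof_irrelevance.
Qed.

Lemma csq_JMeq (p q r s : cob) (a a' : chom p q) (b b' : chom r s) (u u' : cver p r)
  (v v' : cver q s) (x : csq a b u v) (y : csq a' b' u' v') :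
  a = a' -> b = b' -> u = u' -> v = v' ->
  <[sb x]> = <[sb y]> -> <[sa x]> = <[sa y]> -> JMeq x y.
Proof.
  intros <- <- <- <- H H'. rewrite (csq_eq H H'). reflexivity.
Qed.

(** Transparent, so that [hb] and [ha] compute; only the proof of invertibility is sealed. *)
Definition pchom (p q : cob) (b : hom (cY p) (cY q)) (a : hom (cX p) (cX q)) (x : psq B)
  (H : pinv x (hcmp b (ce p)) (hcmp (ce q) (fh F a))) : chom p q.
Proof.
  refine (@MkChom p q b a (of_ty (proj1 H)) _).
  abstract (rewrite pk_of_ty; exact H).
Defined.

Lemma chid_pinv (p : cob) :
  pinv <[sqv1 (ce p)]> (hcmp (hid _) (ce p)) (hcmp (ce p) (fh F (hid _))).
Proof. eapply pinv_conv; [apply pinv_1 | bdry ..]. Qed.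
Definition chid (p : cob) : chom p p := pchom (chid_pinv p).

(** The pasting is the one in [t_comp] without its compositor, which makes the lifted compositors
    satisfy that law. *)
Lemma chcmp_pinv (p q r : cob) (h' : chom q r) (h : chom p q) :
  pinv ((<[hphi h]> ** <[sqv1 (hb h')]>) // (<[sqv1 (fh F (ha h))]> ** <[hphi h']>))
    (hcmp (hcmp (hb h') (hb h)) (ce p)) (hcmp (ce r) (fh F (hcmp (ha h') (ha h)))).
Proof.
  eapply pinv_conv;
    [eapply pinv_v; [eapply pinv_h; [apply hphi_inv | apply pinv_1]
                    |eapply pinv_h; [apply pinv_1 | apply hphi_inv] | bdry] | bdry ..].
Qed.
Definition chcmp (p q r : cob) (h' : chom q r) (h : chom p q) : chom p r :=
  pchom (chcmp_pinv h' h).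

Lemma cvid_ty (p : cob) : ty <[sqv1 (ce p)]> (ce p) (ce p) (fv F (vid (cX p))) (vid (cY p)).
Proof. eapply ty_conv; [ty | bdry ..]. Qed.
Definition cvid (p : cob) : cver p p := MkCver (of_ty (cvid_ty p)).

Lemma cvcmp_ty (p q r : cob) (u' : cver q r) (u : cver p q) :
  ty (<[vs u]> // <[vs u']>) (ce p) (ce r) (fv F (vcmp (va u') (va u)))
    (vcmp (vb u') (vb u)).
Proof. eapply ty_conv; [ty | bdry ..]. Qed.
Definition cvcmp (p q r : cob) (u' : cver q r) (u : cver p q) : cver p r :=
  MkCver (of_ty (cvcmp_ty u' u)).

Lemma chid_phi (p : cob) : <[hphi (chid p)]> = <[sqv1 (ce p)]>.
Proof. apply pk_of_ty. Qed.
Lemma chcmp_phi (p q r : cob) (h' : chom q r) (h : chom p q) :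
  <[hphi (chcmp h' h)]> =
  (<[hphi h]> ** <[sqv1 (hb h')]>) // (<[sqv1 (fh F (ha h))]> ** <[hphi h']>).
Proof. apply pk_of_ty. Qed.
Lemma cvid_vs (p : cob) : <[vs (cvid p)]> = <[sqv1 (ce p)]>.
Proof. apply pk_of_ty. Qed.
Lemma cvcmp_vs (p q r : cob) (u' : cver q r) (u : cver p q) :
  <[vs (cvcmp u' u)]> = <[vs u]> // <[vs u']>.
Proof. apply pk_of_ty. Qed.

Lemma csqh1_compat (p q : cob) (u : cver p q) :
  <[hphi (chid p)]> // (<[fs F (sqh1 (va u))]> ** <[vs u]>) =
  (<[vs u]> ** <[sqh1 (vb u)]>) // <[hphi (chid q)]>.
Proof.
  rewrite !chid_phi, pk_fh1, (hc1l (ty_pk (vs u))), (hc1r (ty_pk (vs u))),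
    (vc1l (ty_pk (vs u))), (vc1r (ty_pk (vs u))) by reflexivity.
  reflexivity.
Qed.
Definition csqh1 (p q : cob) (u : cver p q) : csq (chid p) (chid q) u u :=
  @MkCsq _ _ _ _ (chid p) (chid q) u u (sqh1 (vb u)) (sqh1 (va u)) (csqh1_compat u).

Lemma csqv1_compat (p q : cob) (a : chom p q) :
  <[hphi a]> // (<[fs F (sqv1 (ha a))]> ** <[vs (cvid q)]>) =
  (<[vs (cvid p)]> ** <[sqv1 (hb a)]>) // <[hphi a]>.
Proof.
  rewrite !cvid_vs, pk_fv1, <- !pk_v1_hcmp,
    (vc1l (ty_pk (hphi a))), (vc1r (ty_pk (hphi a))) by reflexivity.
  reflexivity.
Qed.
Definition csqv1 (p q : cob) (a : chom p q) : csq a a (cvid p) (cvid q) :=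
  @MkCsq _ _ _ _ a a (cvid p) (cvid q) (sqv1 (hb a)) (sqv1 (ha a)) (csqv1_compat a).

(** The vertical square travels left in two steps: the compatibility of [t] replaces [vs w] by
    [vs v], that of [s] replaces [vs v] by [vs u]. Interchange isolates the half concerned each
    time. *)
Lemma csqh_compat (X0 X1 X2 Y0 Y1 Y2 : cob) (a : chom X0 X1) (a' : chom X1 X2)
    (b : chom Y0 Y1) (b' : chom Y1 Y2) (u : cver X0 Y0) (v : cver X1 Y1) (w : cver X2 Y2)
    (s : csq a b u v) (t : csq a' b' v w) :
  <[hphi (chcmp a' a)]> // (<[fs F (sqh (sa s) (sa t))]> ** <[vs w]>) =
  (<[vs u]> ** <[sqh (sb s) (sb t)]>) // <[hphi (chcmp b' b)]>.
Proof.
  rewrite !chcmp_phi, pk_fh, pk_h, <- vcA, <- hcA.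
  exch <[sqv1 (fh F (ha a))]> <[hphi a']> <[fs F (sa s)]> (<[fs F (sa t)]> ** <[vs w]>).
  rewrite (vc1l (ty_pk (fs F (sa s)))), (s_compat t) by reflexivity.
  rewrite <- (vc1r (ty_pk (fs F (sa s))) eq_refl).
  exchr <[fs F (sa s)]> (<[vs v]> ** <[sb t]>) <[sqv1 (fh F (ha b))]> <[hphi b']>.
  rewrite !vcA. f_equal. rewrite !hcA.
  exch <[hphi a]> <[sqv1 (hb a')]> (<[fs F (sa s)]> ** <[vs v]>) <[sb t]>.
  rewrite (s_compat s), (vc1l (ty_pk (sb t))) by reflexivity.
  exch (<[vs u]> ** <[sb s]>) <[sb t]> <[hphi b]> <[sqv1 (hb b')]>.
  rewrite (vc1r (ty_pk (sb t))) by reflexivity.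
  reflexivity.
Qed.
Definition csqh (X0 X1 X2 Y0 Y1 Y2 : cob) (a : chom X0 X1) (a' : chom X1 X2)
    (b : chom Y0 Y1) (b' : chom Y1 Y2) (u : cver X0 Y0) (v : cver X1 Y1) (w : cver X2 Y2)
    (s : csq a b u v) (t : csq a' b' v w) : csq (chcmp a' a) (chcmp b' b) u w :=
  @MkCsq _ _ _ _ (chcmp a' a) (chcmp b' b) u w (sqh (sb s) (sb t)) (sqh (sa s) (sa t))
    (csqh_compat s t).

Lemma csqv_compat (X0 X1 Y0 Y1 Z0 Z1 : cob) (a : chom X0 X1) (b : chom Y0 Y1)
    (c : chom Z0 Z1) (u : cver X0 Y0) (v : cver X1 Y1) (u' : cver Y0 Z0) (v' : cver Y1 Z1)
    (s : csq a b u v) (t : csq b c u' v') :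
  <[hphi a]> // (<[fs F (sqv (sa s) (sa t))]> ** <[vs (cvcmp v' v)]>) =
  (<[vs (cvcmp u' u)]> ** <[sqv (sb s) (sb t)]>) // <[hphi c]>.
Proof.
  rewrite !cvcmp_vs, pk_fv, pk_v.
  exchr <[fs F (sa s)]> <[vs v]> <[fs F (sa t)]> <[vs v']>.
  rewrite vcA, (s_compat s), <- vcA, (s_compat t), vcA.
  exch <[vs u]> <[sb s]> <[vs u']> <[sb t]>. reflexivity.
Qed.
Definition csqv (X0 X1 Y0 Y1 Z0 Z1 : cob) (a : chom X0 X1) (b : chom Y0 Y1)
    (c : chom Z0 Z1) (u : cver X0 Y0) (v : cver X1 Y1) (u' : cver Y0 Z0) (v' : cver Y1 Z1)
    (s : csq a b u v) (t : csq b c u' v') : csq a c (cvcmp u' u) (cvcmp v' v) :=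
  @MkCsq _ _ _ _ a c (cvcmp u' u) (cvcmp v' v) (sqv (sb s) (sb t)) (sqv (sa s) (sa t))
    (csqv_compat s t).

Definition comma_data : DblData := {|
  ob := cob; hom := chom; ver := cver; sq := csq;
  hid := chid; hcmp := chcmp; vid := cvid; vcmp := cvcmp;
  sqh1 := csqh1; sqv1 := csqv1; sqh := csqh; sqv := csqv |}.

Lemma chcmpA (W X Y Z : cob) (a : chom W X) (b : chom X Y) (c : chom Y Z) :
  chcmp c (chcmp b a) = chcmp (chcmp c b) a.
Proof.
  apply chom_eq; [apply hA | apply hA |].
  rewrite !chcmp_phi. simpl.
  erewrite vc_whisker_r, vc_whisker_l; [| ty | ty | bdry | ty | ty | bdry].
  rewrite Fh_cmp, !pk_v1_hcmp, !hcA, !vcA. reflexivity.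
Qed.

Lemma chcmp1l (X Y : cob) (a : chom X Y) : chcmp (chid Y) a = a.
Proof.
  apply chom_eq; [apply h1l | apply h1l |].
  rewrite chcmp_phi, chid_phi. simpl.
  rewrite (hc_id_r (ty_pk (hphi a))), <- pk_v1_hcmp. apply (vc1r (ty_pk _)). reflexivity.
Qed.

Lemma chcmp1r (X Y : cob) (a : chom X Y) : chcmp a (chid X) = a.
Proof.
  apply chom_eq; [apply h1r | apply h1r |].
  rewrite chcmp_phi, chid_phi. simpl.
  rewrite Fh_id, (hc_id_l (ty_pk (hphi a))), <- pk_v1_hcmp.
  apply (vc1l (ty_pk _)). reflexivity.
Qed.

Lemma cvcmpA (W X Y Z : cob) (a : cver W X) (b : cver X Y) (c : cver Y Z) :
  cvcmp c (cvcmp b a) = cvcmp (cvcmp c b) a.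
Proof.
  apply cver_eq; [apply vA | apply vA |]. rewrite !cvcmp_vs. symmetry; apply vcA.
Qed.

Lemma cvcmp1l (X Y : cob) (a : cver X Y) : cvcmp (cvid Y) a = a.
Proof.
  apply cver_eq; [apply v1l | apply v1l |]. rewrite cvcmp_vs, cvid_vs.
  apply (vc1r (ty_pk _)); reflexivity.
Qed.

Lemma cvcmp1r (X Y : cob) (a : cver X Y) : cvcmp a (cvid X) = a.
Proof.
  apply cver_eq; [apply v1r | apply v1r |]. rewrite cvcmp_vs, cvid_vs.
  apply (vc1l (ty_pk _)); reflexivity.
Qed.

Lemma comma_ax : IsDblCat comma_data.
Proof.
  split; simpl; intros.
  - apply chcmpA.
  - apply chcmp1l.
  - apply chcmp1r.
  - apply cvcmpA.
  - apply cvcmp1l.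
  - apply cvcmp1r.
  - apply csq_JMeq; auto using chcmpA; simpl; rewrite !pk_h; apply hcA.
  - apply csq_JMeq; auto using chcmp1r; simpl; rewrite !pk_h; apply (hc1l (ty_pk _)); reflexivity.
  - apply csq_JMeq; auto using chcmp1l; simpl; rewrite !pk_h; apply (hc1r (ty_pk _)); reflexivity.
  - apply csq_JMeq; auto using cvcmpA; simpl; rewrite !pk_v; apply vcA.
  - apply csq_JMeq; auto using cvcmp1r; simpl; rewrite !pk_v; apply (vc1l (ty_pk _)); reflexivity.
  - apply csq_JMeq; auto using cvcmp1l; simpl; rewrite !pk_v; apply (vc1r (ty_pk _)); reflexivity.
  - apply csq_eq; simpl; rewrite !pk_v; apply pk_h1_vcmp.
  - apply csq_eq; simpl; apply pk_h1_vid.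
  - apply csq_eq; simpl; rewrite !pk_h; apply pk_v1_hcmp.
  - apply csq_eq; simpl; f_equal; apply interchange, dax.
Qed.

Definition comma : DblCat := MkDblCat comma_ax.

End Comma.

Lemma wh_inv_transport (D : DblCat) (X Y X' Y' : ob D) (u u' : ver X X') (v v' : ver Y Y')
  (a a' : hom X Y) (b b' : hom X' Y') (s : sq a b u v) (s' : sq a' b' u' v') :
  <[s]> = <[s']> -> wh_inv s -> wh_inv s'.
Proof. intros H. dependent destruction H. auto. Qed.

Lemma cvid_wh_inv (A B : DblCat) (F : DFun A B) (p : cob F) : wh_inv (vs (cvid p)).
Proof.
  eapply wh_inv_transport; [symmetry; apply cvid_vs | apply wh_inv_sqv1, ce_equiv].
Qed.
#[export] Hint Resolve cvid_wh_inv : core.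

Section Projections.
Context (A B : DblCat) (F : DFun A B).

Lemma sb_csqh (X0 X1 X2 Y0 Y1 Y2 : cob F) (a : chom X0 X1) (a' : chom X1 X2)
    (b : chom Y0 Y1) (b' : chom Y1 Y2) (u : cver X0 Y0) (v : cver X1 Y1) (w : cver X2 Y2)
    (s : csq a b u v) (t : csq a' b' v w) : <[sb (csqh s t)]> = <[sb s]> ** <[sb t]>.
Proof. apply pk_h. Qed.

Lemma sb_csqv (X0 X1 Y0 Y1 Z0 Z1 : cob F) (a : chom X0 X1) (b : chom Y0 Y1)
    (c : chom Z0 Z1) (u : cver X0 Y0) (v : cver X1 Y1) (u' : cver Y0 Z0) (v' : cver Y1 Z1)
    (s : csq a b u v) (t : csq b c u' v') : <[sb (csqv s t)]> = <[sb s]> // <[sb t]>.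
Proof. apply pk_v. Qed.

Lemma sb_csqh1 (p q : cob F) (u : cver p q) : <[sb (csqh1 u)]> = <[sqh1 (vb u)]>.
Proof. reflexivity. Qed.

Lemma sb_csqv1 (p q : cob F) (a : chom p q) : <[sb (csqv1 a)]> = <[sqv1 (hb a)]>.
Proof. reflexivity. Qed.

Lemma sb_cast (p q r s : cob F) (a a' : chom p q) (b b' : chom r s) (u u' : cver p r)
  (v v' : cver q s) (ea : a = a') (eb : b = b') (eu : u = u') (ev : v = v')
  (x : csq a b u v) :
  <[sb (@sqcast (comma_data F) _ _ _ _ _ _ _ _ _ _ _ _ ea eb eu ev x)]> = <[sb x]>.
Proof. destruct ea, eb, eu, ev; reflexivity. Qed.

Lemma sa_csqh (X0 X1 X2 Y0 Y1 Y2 : cob F) (a : chom X0 X1) (a' : chom X1 X2)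
    (b : chom Y0 Y1) (b' : chom Y1 Y2) (u : cver X0 Y0) (v : cver X1 Y1) (w : cver X2 Y2)
    (s : csq a b u v) (t : csq a' b' v w) : <[sa (csqh s t)]> = <[sa s]> ** <[sa t]>.
Proof. apply pk_h. Qed.

Lemma sa_csqv (X0 X1 Y0 Y1 Z0 Z1 : cob F) (a : chom X0 X1) (b : chom Y0 Y1)
    (c : chom Z0 Z1) (u : cver X0 Y0) (v : cver X1 Y1) (u' : cver Y0 Z0) (v' : cver Y1 Z1)
    (s : csq a b u v) (t : csq b c u' v') : <[sa (csqv s t)]> = <[sa s]> // <[sa t]>.
Proof. apply pk_v. Qed.

Lemma sa_csqh1 (p q : cob F) (u : cver p q) : <[sa (csqh1 u)]> = <[sqh1 (va u)]>.
Proof. reflexivity. Qed.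

Lemma sa_csqv1 (p q : cob F) (a : chom p q) : <[sa (csqv1 a)]> = <[sqv1 (ha a)]>.
Proof. reflexivity. Qed.

Lemma sa_cast (p q r s : cob F) (a a' : chom p q) (b b' : chom r s) (u u' : cver p r)
  (v v' : cver q s) (ea : a = a') (eb : b = b') (eu : u = u') (ev : v = v')
  (x : csq a b u v) :
  <[sa (@sqcast (comma_data F) _ _ _ _ _ _ _ _ _ _ _ _ ea eb eu ev x)]> = <[sa x]>.
Proof. destruct ea, eb, eu, ev; reflexivity. Qed.

End Projections.

(** * Lifting morphisms and squares along the projection to [B] *)

Section Lift.
Context (A B : DblCat) (F : DFun A B) (HF : double_biequiv F).

(** Dividing [hcmp b (ce p)] by the equivalence [ce q] gives a morphism between images of objects of
    [A], which (db2) replaces by some [fh F g]. *)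
Lemma hom_lift_exists (p q : cob F) (b : hom (cY p) (cY q)) :
  exists h : chom p q, hb h = b.
Proof.
  destruct HF as (_ & db2 & _).
  destruct (hequiv_lift (hcmp b (ce p)) (ce_equiv q)) as [c Hc].
  destruct (db2 _ _ c) as [g Hg].
  assert (H : hiso (hcmp b (ce p)) (hcmp (ce q) (fh F g))).
  { rewrite Hc. apply hiso_hcmp; [exact Hg | reflexivity]. }
  apply hisoE in H. destruct H as [x Hx]. exists (pchom Hx). reflexivity.
Qed.

(** Compatibility is an equation for the image under [F] of the missing square: fullness of
    whiskering with [vs v] solves it, and (db4) descends the solution to [A]. *)
Lemma sq_lift_exists (p q r s : cob F) (a : chom p q) (b : chom r s) (u : cver p r)
  (v : cver q s) (W : wh_inv (vs v)) (be : sq (hb a) (hb b) (vb u) (vb v)) :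
  exists x : csq a b u v, sb x = be.
Proof.
  destruct HF as (_ & _ & _ & db4).
  destruct (hphi_inv a) as (Ta & i & Ti & I1 & I2).
  destruct (whisker_full_ty W (p := i // (<[vs u]> ** <[be]>) // <[hphi b]>)
              (f := fh F (ha a)) (g := fh F (ha b)) (x := fv F (va u))) as [de Hde].
  { eapply ty_conv; [ty | bdry ..]. }
  destruct (db4 _ _ _ _ _ _ _ _ de) as (ga & Hga & _).
  unshelve eexists (@MkCsq _ _ _ _ _ _ _ a b u v be ga _); [|reflexivity].
  rewrite Hga, Hde, !vcA, I1. f_equal. eapply vc1l; [ty | bdry].
Qed.

(** The same equation has at most one solution, by faithfulness of the whiskering and uniqueness in
    (db4). *)
Lemma sq_lift_unique (p q r s : cob F) (a : chom p q) (b : chom r s) (u : cver p r)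
  (v : cver q s) (x y : csq a b u v) :
  wh_inv (vs v) -> sb x = sb y -> x = y.
Proof.
  intros W E. destruct HF as (_ & _ & _ & db4).
  destruct (hphi_inv a) as (Ta & i & Ti & I1 & I2).
  pose proof (s_compat x) as Hx. pose proof (s_compat y) as Hy.
  rewrite E, <- Hy in Hx.
  eapply vcancel_l in Hx; [| exact I2 | ty | ty | bdry | bdry].
  apply (whisker_faithful W) in Hx.
  apply csq_eq; [f_equal; exact E | f_equal].
  destruct (db4 _ _ _ _ _ _ _ _ (fs F (sa y))) as (ga & _ & U).
  rewrite <- (U (sa x)), <- (U (sa y)); auto.
Qed.

(** The working form of uniqueness: a coherence law in [A] becomes an equation in [B], mostly
    between identity squares. Propositional equality of the boundaries suits laws whose sides are
    not convertible in type. *)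
Lemma sa_unique (p q r s : cob F) (a a' : chom p q) (b b' : chom r s) (u u' : cver p r)
  (v v' : cver q s) (x : csq a b u v) (y : csq a' b' u' v') :
  a = a' -> b = b' -> u = u' -> v = v' -> wh_inv (vs v) ->
  <[sb x]> = <[sb y]> -> <[sa x]> = <[sa y]>.
Proof.
  intros <- <- <- <- W E. rewrite (@sq_lift_unique _ _ _ _ _ _ _ _ x y); auto.
  apply pk_inj; exact E.
Qed.

Definition lift (p q r s : cob F) (a : chom p q) (b : chom r s) (u : cver p r)
  (v : cver q s) (W : wh_inv (vs v)) (be : sq (hb a) (hb b) (vb u) (vb v)) : csq a b u v :=
  proj1_sig (constructive_indefinite_description _ (sq_lift_exists W be)).

Lemma sb_lift (p q r s : cob F) (a : chom p q) (b : chom r s) (u : cver p r)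
  (v : cver q s) (W : wh_inv (vs v)) (be : sq (hb a) (hb b) (vb u) (vb v)) :
  sb (lift W be) = be.
Proof. exact (proj2_sig (constructive_indefinite_description _ (sq_lift_exists W be))). Qed.

Lemma lift_ty (p q r s : cob F) (a : chom p q) (b : chom r s) (u : cver p r)
  (v : cver q s) x : wh_inv (vs v) -> ty x (hb a) (hb b) (vb u) (vb v) ->
  exists y : csq a b u v, <[sb y]> = x.
Proof. intros W [be ->]. exists (lift W be). f_equal. apply sb_lift. Qed.

Lemma sa_cancel (p q : cob F) (a b : chom p q) (x : csq a b (cvid p) (cvid q))
  (y : csq b a (cvid p) (cvid q)) :
  <[sb x]> // <[sb y]> = <[sqv1 (hb a)]> -> <[sa x]> // <[sa y]> = <[sqv1 (ha a)]>.
Proof.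
  intros E. rewrite <- sa_csqv.
  apply (@sa_unique _ _ _ _ _ _ _ _ _ _ _ _ (csqv x y) (csqv1 a)); auto using cvcmp1l.
  - rewrite cvcmp1l; auto.
  - rewrite sb_csqv. exact E.
Qed.

(** The inverse in [B] lifts, since identity boundaries are weakly horizontally invertible, and
    uniqueness makes its lift an inverse. *)
Lemma sa_vinv (p q : cob F) (a b : chom p q) (x : csq a b (cvid p) (cvid q)) :
  pinv <[sb x]> (hb a) (hb b) -> vinv (sa x).
Proof.
  intros (_ & i & Ti & I1 & I2).
  destruct (lift_ty (a := b) (b := a) (u := cvid p) (cvid_wh_inv q) Ti) as [y Hy].
  subst i. apply (proj2 (@vinvE A _ _ _ _ (sa x))). exists (sa y).
  split; apply sa_cancel; assumption.
Qed.

Definition plift (p q r s : cob F) (a : chom p q) (b : chom r s) (u : cver p r)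
  (v : cver q s) x (W : wh_inv (vs v)) (T : ty x (hb a) (hb b) (vb u) (vb v)) :
  csq a b u v := lift W (of_ty T).

Lemma sb_plift (p q r s : cob F) (a : chom p q) (b : chom r s) (u : cver p r)
  (v : cver q s) x (W : wh_inv (vs v)) (T : ty x (hb a) (hb b) (vb u) (vb v)) :
  <[sb (plift W T)]> = x.
Proof. unfold plift. rewrite sb_lift. apply pk_of_ty. Qed.

Lemma sa_va_iso (p q r s : cob F) (a c : chom p q) (b d : chom r s) (u : cver p r)
  (v : cver q s) (x : csq a b u v) (y : csq c d u v) :
  wh_inv (vs v) -> va_iso (sb x) (sb y) -> va_iso (sa x) (sa y).
Proof.
  intros W H. apply va_isoE in H.
  destruct H as (s0 & s1 & t0 & t1 & H1 & H2 & H3 & H4 & H5 & H6).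
  destruct (lift_ty (a := a) (b := c) (u := cvid p) (cvid_wh_inv q) (ty_pk s0)) as [S0 E0].
  destruct (lift_ty (a := b) (b := d) (u := cvid r) (cvid_wh_inv s) (ty_pk s1)) as [S1 E1].
  destruct (lift_ty (a := c) (b := a) (u := cvid p) (cvid_wh_inv q) (ty_pk t0)) as [T0 E2].
  destruct (lift_ty (a := d) (b := b) (u := cvid r) (cvid_wh_inv s) (ty_pk t1)) as [T1 E3].
  rewrite <- E0, <- ?E1, <- ?E2, <- ?E3 in *.
  apply va_isoE. exists (sa S0), (sa S1), (sa T0), (sa T1).
  split; [|split; [|repeat split]].
  - refine (eq_trans (eq_sym (sa_csqv S0 y)) (eq_trans _ (sa_csqv x S1))).
    apply sa_unique; auto;
      rewrite ?cvcmp1l, ?cvcmp1r; auto. rewrite !sb_csqv; auto.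
  - refine (eq_trans (eq_sym (sa_csqv T0 x)) (eq_trans _ (sa_csqv y T1))).
    apply sa_unique; auto;
      rewrite ?cvcmp1l, ?cvcmp1r; auto. rewrite !sb_csqv; auto.
  - apply sa_cancel; assumption.
  - apply sa_cancel; assumption.
  - apply sa_cancel; assumption.
  - apply sa_cancel; assumption.
Qed.

(** The inverse runs from [v] to [u], so lifting it uses invertibility of [vs u]. The laws for the
    two composites are then tested over [vs u] and over [vs v]. *)
Lemma sa_wh_inv (p q r s : cob F) (a : chom p q) (b : chom r s) (u : cver p r)
  (v : cver q s) (x : csq a b u v) :
  wh_inv (vs u) -> wh_inv (vs v) -> wh_inv (sb x) -> wh_inv (sa x).
Proof.
  intros Wu Wv (c & d & be & H & H').
  destruct (hom_lift_exists c) as [c' Ec].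
  destruct (hom_lift_exists d) as [d' Ed].
  subst c d.
  destruct (lift_ty (a := c') (b := d') (u := v) Wu (ty_pk be)) as [y Ey].
  apply pk_inj in Ey. subst be.
  exists (ha c'), (ha d'), (sa y). split.
  - exact (@sa_va_iso _ _ _ _ _ _ _ _ _ _ (csqh x y) (csqh1 u) Wu H).
  - exact (@sa_va_iso _ _ _ _ _ _ _ _ _ _ (csqh y x) (csqh1 v) Wv H').
Qed.

End Lift.

(** * The canonical copy of [A] in the comma double category *)

Section Trivial.
Context (A B : DblCat) (F : DFun A B).

Definition trivO (X : ob A) : cob F := MkCob (hequiv_hid (fo F X)).

Lemma trivH_pinv (X Y : ob A) (a : hom X Y) :
  pinv <[sqv1 (fh F a)]> (hcmp (fh F a) (hid _)) (hcmp (hid _) (fh F a)).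
Proof. eapply pinv_conv; [apply pinv_1 | bdry ..]. Qed.
Definition trivH (X Y : ob A) (a : hom X Y) : chom (trivO X) (trivO Y) :=
  @pchom _ _ F (trivO X) (trivO Y) (fh F a) a _ (trivH_pinv a).
Definition trivV (X Y : ob A) (u : ver X Y) : cver (trivO X) (trivO Y) :=
  @MkCver _ _ F (trivO X) (trivO Y) (fv F u) u (sqh1 (fv F u)).

Lemma trivH_phi (X Y : ob A) (a : hom X Y) : <[hphi (trivH a)]> = <[sqv1 (fh F a)]>.
Proof. apply pk_of_ty. Qed.

Lemma trivS_compat (X Y Z W : ob A) (a : hom X Y) (b : hom Z W) (u : ver X Z) (v : ver Y W)
  (s : sq a b u v) :
  <[hphi (trivH a)]> // (<[fs F s]> ** <[vs (trivV v)]>) =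
  (<[vs (trivV u)]> ** <[fs F s]>) // <[hphi (trivH b)]>.
Proof.
  rewrite !trivH_phi. simpl.
  rewrite (hc1l (ty_pk (fs F s))), (hc1r (ty_pk (fs F s))),
    (vc1l (ty_pk (fs F s))), (vc1r (ty_pk (fs F s))); reflexivity.
Qed.
Definition trivS (X Y Z W : ob A) (a : hom X Y) (b : hom Z W) (u : ver X Z) (v : ver Y W)
  (s : sq a b u v) : csq (trivH a) (trivH b) (trivV u) (trivV v) :=
  @MkCsq _ _ F _ _ _ _ (trivH a) (trivH b) (trivV u) (trivV v) (fs F s) s (trivS_compat s).

Lemma trivH_cmp (X Y Z : ob A) (a : hom X Y) (b : hom Y Z) :
  trivH (hcmp b a) = chcmp (trivH b) (trivH a).
Proof.
  apply chom_eq; [apply Fh_cmp | reflexivity |].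
  rewrite chcmp_phi, !trivH_phi. simpl. rewrite <- !pk_v1_hcmp, Fh_cmp.
  symmetry; apply (vc1l (ty_pk _)); reflexivity.
Qed.

Lemma trivH_id (X : ob A) : trivH (hid X) = chid (trivO X).
Proof.
  apply chom_eq; [apply Fh_id | reflexivity |].
  rewrite chid_phi, trivH_phi, Fh_id. reflexivity.
Qed.

Lemma trivV_cmp (X Y Z : ob A) (u : ver X Y) (v : ver Y Z) :
  trivV (vcmp v u) = cvcmp (trivV v) (trivV u).
Proof.
  apply cver_eq; [apply Fv_cmp | reflexivity |].
  rewrite cvcmp_vs. simpl. rewrite Fv_cmp. apply pk_h1_vcmp.
Qed.

Lemma trivV_id (X : ob A) : trivV (vid X) = cvid (trivO X).
Proof.
  apply cver_eq; [apply Fv_id | reflexivity |].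
  rewrite cvid_vs. simpl. rewrite Fv_id. apply pk_h1_vid.
Qed.

Lemma trivV_wh (X Y : ob A) (u : ver X Y) : wh_inv (vs (trivV u)).
Proof. apply wh_inv_sqh1. Qed.

End Trivial.

(** * The pseudo inverse, counit and unit obtained from a section *)

Section Inverse.
Context (A B : DblCat) (F : DFun A B) (HF : double_biequiv F).
Context (sO : forall Y : ob B, {X : ob A & {e : hom (fo F X) Y | hequiv e}}).

Definition secO (Y : ob B) : cob F := MkCob (proj2_sig (projT2 (sO Y))).

Context (gV : forall Y Y' : ob B, ver Y Y' -> cver (secO Y) (secO Y')).
Arguments gV {Y Y'}.
Context (gV_b : forall (Y Y' : ob B) (v : ver Y Y'), vb (gV v) = v)
  (gV_wh : forall (Y Y' : ob B) (v : ver Y Y'), wh_inv (vs (gV v)))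
  (gV_id : forall Y : ob B, gV (vid Y) = cvid (secO Y))
  (gV_cmp : forall (X Y Z : ob B) (u : ver X Y) (v : ver Y Z),
      gV (vcmp v u) = cvcmp (gV v) (gV u)).
Context (gH : forall Y Y' : ob B, hom Y Y' -> chom (secO Y) (secO Y')).
Arguments gH {Y Y'}.
Context (gH_b : forall (Y Y' : ob B) (b : hom Y Y'), hb (gH b) = b)
  (gH_id : forall Y : ob B, gH (hid Y) = chid (secO Y)).

(* [secV v] and [secH b] equal [gV v] and [gH b], but lie over [v] and [b] definitionally. *)
Lemma secV_ty (Y Y' : ob B) (v : ver Y Y') :
  ty <[vs (gV v)]> (ce (secO Y)) (ce (secO Y')) (fv F (va (gV v))) v.
Proof. eapply ty_conv; [ty | auto ..]. Qed.
Definition secV (Y Y' : ob B) (v : ver Y Y') : cver (secO Y) (secO Y') :=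
  @MkCver _ _ F (secO Y) (secO Y') v (va (gV v)) (of_ty (secV_ty v)).
Lemma secVE (Y Y' : ob B) (v : ver Y Y') : secV v = gV v.
Proof. apply cver_eq; [symmetry; apply gV_b | reflexivity | apply pk_of_ty]. Qed.

Lemma secH_pinv (Y Y' : ob B) (b : hom Y Y') :
  pinv <[hphi (gH b)]> (hcmp b (ce (secO Y))) (hcmp (ce (secO Y')) (fh F (ha (gH b)))).
Proof. eapply pinv_conv; [apply hphi_inv | rewrite gH_b; auto | auto]. Qed.
Definition secH (Y Y' : ob B) (b : hom Y Y') : chom (secO Y) (secO Y') :=
  @pchom _ _ F (secO Y) (secO Y') b (ha (gH b)) _ (secH_pinv b).
Lemma secHE (Y Y' : ob B) (b : hom Y Y') : secH b = gH b.
Proof. apply chom_eq; [symmetry; apply gH_b | reflexivity | apply pk_of_ty]. Qed.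

Lemma secV_wh (Y Y' : ob B) (v : ver Y Y') : wh_inv (vs (secV v)).
Proof. rewrite secVE. apply gV_wh. Qed.
Hint Resolve secV_wh : core.

Lemma secV_id (Y : ob B) : secV (vid Y) = cvid (secO Y).
Proof. rewrite secVE; apply gV_id. Qed.
Lemma secV_cmp (X Y Z : ob B) (u : ver X Y) (v : ver Y Z) :
  secV (vcmp v u) = cvcmp (secV v) (secV u).
Proof. rewrite !secVE; apply gV_cmp. Qed.
Lemma secH_id (Y : ob B) : secH (hid Y) = chid (secO Y).
Proof. rewrite secHE; apply gH_id. Qed.

Definition secS (X Y Z W : ob B) (a : hom X Y) (b : hom Z W) (u : ver X Z) (v : ver Y W)
  (s : sq a b u v) : csq (secH a) (secH b) (secV u) (secV v) :=
  @lift _ _ F HF _ _ _ _ (secH a) (secH b) (secV u) (secV v) (secV_wh v) s.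

(** Top and bottom may differ as comma morphisms, but both lie over [hcmp b a] by computation, so
    its identity square can be lifted. *)
Definition secC (X Y Z : ob B) (a : hom X Y) (b : hom Y Z) :
  csq (chcmp (secH b) (secH a)) (secH (hcmp b a)) (cvid _) (cvid _) :=
  @lift _ _ F HF _ _ _ _ (chcmp (secH b) (secH a)) (secH (hcmp b a)) (cvid _) (cvid _)
    (cvid_wh_inv _) (sqv1 (hcmp b a)).

Definition secU (X : ob B) : csq (chid (secO X)) (secH (hid X)) (cvid _) (cvid _) :=
  @lift _ _ F HF _ _ _ _ (chid (secO X)) (secH (hid X)) (cvid _) (cvid _)
    (cvid_wh_inv _) (sqv1 (hid X)).

Lemma sb_secS (X Y Z W : ob B) (a : hom X Y) (b : hom Z W) (u : ver X Z) (v : ver Y W)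
  (s : sq a b u v) : <[sb (secS s)]> = <[s]>.
Proof. unfold secS. rewrite sb_lift. reflexivity. Qed.
Lemma sb_secC (X Y Z : ob B) (a : hom X Y) (b : hom Y Z) :
  <[sb (secC a b)]> = <[sqv1 (hcmp b a)]>.
Proof. unfold secC. rewrite sb_lift. reflexivity. Qed.
Lemma sb_secU (X : ob B) : <[sb (secU X)]> = <[sqv1 (hid X)]>.
Proof. unfold secU. rewrite sb_lift. reflexivity. Qed.

Definition quasi_invD : HPFD B A := {|
  po := fun Y => cX (secO Y);
  ph := fun X Y b => ha (secH b);
  pv := fun X Y v => va (secV v);
  ps := fun X Y Z W a b u v s => sa (secS s);
  pcomp := fun X Y Z a b => sa (secC a b);
  punit := fun X => sa (secU X) |}.

Ltac over x y :=
  apply (@sa_unique _ _ _ HF _ _ _ _ _ _ _ _ _ _ _ _ x y).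

Ltac cbd := solve [ reflexivity | auto | rewrite ?secV_id, ?secV_cmp, ?secH_id, ?cvcmp1l, ?cvcmp1r,
  ?chcmp1l, ?chcmp1r, ?chcmpA; auto ].
Ltac sbs := repeat first [rewrite sb_cast | rewrite sb_csqh | rewrite sb_csqv
  | rewrite sb_csqh1 | rewrite sb_csqv1 | rewrite sb_secS | rewrite sb_secC | rewrite sb_secU].

Lemma quasi_inv_ax : IsHPF quasi_invD.
Proof.
  split; intros.
  - change (va (secV (vcmp v u)) = va (cvcmp (secV v) (secV u))). rewrite secV_cmp; auto.
  - change (va (secV (vid X)) = va (cvid (secO X))). rewrite secV_id; auto.
  - apply pk_JMeq. over (secS (sqv s1 s2)) (csqv (secS s1) (secS s2)); try cbd.
    sbs. apply pk_v.
  - apply pk_JMeq. over (secS (sqv1 a)) (csqv1 (secH a)); try cbd.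
    sbs. reflexivity.
  - apply (sa_vinv HF (x := secC a b)). rewrite sb_secC. apply pinv_1.
  - apply (sa_vinv HF (x := secU X)). rewrite sb_secU. apply pinv_1.
  - apply pk_JMeq.
    (* The two pastings end in the chosen lifts of the two bracketings, which agree only through
       associativity in [B]. *)
    assert (E : secH (hcmp c (hcmp b a)) = secH (hcmp (hcmp c b) a)) by (rewrite hA; auto).
    over (csqv (csqh (csqv1 (secH a)) (secC b c)) (secC a (hcmp c b)))
         (csqv (csqh (secC a b) (csqv1 (secH c))) (secC (hcmp b a) c)); try cbd.
    sbs. simpl. rewrite !pk_v1_hcmp, !hcA. reflexivity.
  - apply pk_JMeq.
    over (csqv (csqh (secU X) (csqv1 (secH a))) (secC (hid X) a)) (csqv1 (secH a)); try cbd.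
    + rewrite h1r; auto.
    + sbs. simpl. rewrite <- pk_v1_hcmp, h1r. apply (vc1l (ty_pk _)); auto.
  - apply pk_JMeq.
    over (csqv (csqh (csqv1 (secH a)) (secU Y)) (secC a (hid Y))) (csqv1 (secH a)); try cbd.
    + rewrite h1l; auto.
    + sbs. simpl. rewrite <- pk_v1_hcmp, h1l. apply (vc1l (ty_pk _)); auto.
  - apply pk_JMeq.
    over (csqv (csqh (secS s1) (secS s2)) (secC b b'))
         (csqv (secC a a') (secS (sqh s1 s2))); try cbd.
    sbs. rewrite <- pk_h, (vc1l (ty_pk (sqh s1 s2))), (vc1r (ty_pk (sqh s1 s2))); auto.
  - apply pk_JMeq.
    over (csqv (csqh1 (secV u)) (secU X')) (csqv (secU X) (secS (sqh1 u))); try cbd.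
    sbs. simpl. rewrite (vc1l (ty_pk (sqh1 u))), (vc1r (ty_pk (sqh1 u))); auto.
Qed.

Definition quasi_inv : HPF B A := MkHPF quasi_inv_ax.

Lemma quasi_inv_normal : hpf_normal quasi_inv.
Proof.
  intros X. assert (E : ha (secH (hid X)) = hid (cX (secO X))) by (rewrite secH_id; auto).
  exists E. apply pk_JMeq. over (secU X) (csqv1 (chid (secO X))); try cbd.
  sbs. reflexivity.
Qed.

Definition counit_ntD : HPNTD (compFG F quasi_inv) (idD B) :=
  @MkHPNTD B B (compFG F quasi_inv) (idD B)
    (fun Y => ce (secO Y)) (fun Y Y' v => vs (secV v)) (fun Y Y' b => hphi (secH b)).

(** The naturality, composition and unit laws are the compatibilities of the lifts [secS], [secC]
    and [secU]. The two vertical laws are the strictness of the section on vertical morphisms. *)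
Lemma counit_nt_ax : IsHPNT counit_ntD.
Proof.
  split; intros.
  - apply (proj1 (@pinv_vinv B _ _ _ _ (hphi (secH a)))). apply hphi_inv.
  - apply pk_JMeq. pk.
    change (<[vs (secV (vcmp v u))]> = <[vs (secV u)]> // <[vs (secV v)]>).
    rewrite secV_cmp. apply cvcmp_vs.
  - apply pk_JMeq. change (<[vs (secV (vid X))]> = <[sqv1 (ce (secO X))]>).
    rewrite secV_id. apply cvid_vs.
  - apply pk_JMeq. pk. pose proof (s_compat (secS al)) as H.
    rewrite sb_secS in H. exact H.
  - apply pk_JMeq. pk. pose proof (s_compat (secC a b)) as H.
    rewrite sb_secC, !cvid_vs, chcmp_phi in H. simpl. pk. symmetry. exact H.
  - apply pk_JMeq. pk. pose proof (s_compat (secU X)) as H.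
    rewrite sb_secU, !cvid_vs, chid_phi in H. simpl. pk.
    refine (eq_trans (eq_sym H) _). eapply vc1l; [ty | simpl; bdry].
Qed.

Definition counit_nt : HPNT (compFG F quasi_inv) (idD B) := MkHPNT counit_nt_ax.

Lemma counit_nt_equiv : hpnt_equiv counit_nt.
Proof.
  split.
  - intros Y. exact (ce_equiv (secO Y)).
  - intros X Y v. exact (secV_wh v).
Qed.

Definition unitH (X : ob A) : chom (trivO F X) (secO (fo F X)) :=
  proj1_sig (constructive_indefinite_description _
    (@hom_lift_exists _ _ _ HF (trivO F X) (secO (fo F X)) (hid (fo F X)))).

Lemma unitH_b (X : ob A) : hb (unitH X) = hid (fo F X).
Proof.
  exact (proj2_sig (constructive_indefinite_description _
    (@hom_lift_exists _ _ _ HF (trivO F X) (secO (fo F X)) (hid (fo F X))))).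
Qed.

Lemma unitV_ty (X Y : ob A) (u : ver X Y) :
  ty <[sqh1 (fv F u)]> (hb (unitH X)) (hb (unitH Y)) (vb (trivV F u)) (vb (secV (fv F u))).
Proof. rewrite !unitH_b. apply ty_pk. Qed.
Definition unitV (X Y : ob A) (u : ver X Y) :
  csq (unitH X) (unitH Y) (trivV F u) (secV (fv F u)) :=
  plift HF (secV_wh (fv F u)) (unitV_ty u).

Lemma unitT_ty (X Y : ob A) (a : hom X Y) :
  ty <[sqv1 (fh F a)]> (hb (chcmp (secH (fh F a)) (unitH X)))
    (hb (chcmp (unitH Y) (trivH F a))) (vb (cvid (trivO F X))) (vb (cvid (secO (fo F Y)))).
Proof.
  simpl. rewrite !unitH_b. eapply ty_conv; [apply ty_pk | bdry ..].
Qed.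
(** Top and bottom both lie over [fh F a] up to unit laws, so this too lifts an identity. *)
Definition unitT (X Y : ob A) (a : hom X Y) :
  csq (chcmp (secH (fh F a)) (unitH X)) (chcmp (unitH Y) (trivH F a)) (cvid _) (cvid _) :=
  plift HF (cvid_wh_inv _) (unitT_ty a).

Lemma sb_unitV (X Y : ob A) (u : ver X Y) : <[sb (unitV u)]> = <[sqh1 (fv F u)]>.
Proof. apply sb_plift. Qed.
Lemma sb_unitT (X Y : ob A) (a : hom X Y) : <[sb (unitT a)]> = <[sqv1 (fh F a)]>.
Proof. apply sb_plift. Qed.

Definition unit_ntD : HPNTD (idD A) (compGF quasi_inv F) :=
  @MkHPNTD A A (idD A) (compGF quasi_inv F)
    (fun X => ha (unitH X)) (fun X Y u => sa (unitV u)) (fun X Y a => sa (unitT a)).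

Ltac ebd := solve [ cbd | rewrite ?trivV_cmp, ?trivV_id, ?trivH_cmp, ?trivH_id, ?Fv_cmp, ?Fv_id,
  ?Fh_cmp, ?Fh_id; cbd ].
Ltac sas := repeat first [rewrite sa_cast | rewrite sa_csqh | rewrite sa_csqv
  | rewrite sa_csqh1 | rewrite sa_csqv1].
Ltac esbs := repeat first [progress sbs | rewrite sb_unitV | rewrite sb_unitT].

Lemma unit_nt_ax : IsHPNT unit_ntD.
Proof.
  split; intros.
  - apply (sa_vinv HF (x := unitT a)). rewrite sb_unitT.
    eapply pinv_conv; [apply pinv_1 | simpl; rewrite unitH_b; bdry ..].
  - apply pk_JMeq. over (unitV (vcmp v u)) (csqv (unitV u) (unitV v)); try ebd.
    esbs. rewrite Fv_cmp. apply pk_h1_vcmp.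
  - apply pk_JMeq. over (unitV (vid X)) (csqv1 (unitH X)); try ebd.
    esbs. rewrite unitH_b, Fv_id. apply pk_h1_vid.
  - apply pk_JMeq. over (csqv (unitT a) (csqh (trivS F al) (unitV v)))
      (csqv (csqh (unitV u) (secS (fs F al))) (unitT b)); try ebd.
    esbs. simpl.
    rewrite (hc1l (ty_pk (fs F al))), (hc1r (ty_pk (fs F al))),
      (vc1l (ty_pk (fs F al))), (vc1r (ty_pk (fs F al))); reflexivity.
  - apply pk_JMeq.
    (* The compositor of [GF] carries a cast along functoriality of [F]. The cast along [E] mirrors
       it in the comma double category, so that [L] has the left side of the law as its part in
       [A]. *)
    assert (E : secH (hcmp (fh F b) (fh F a)) = secH (fh F (hcmp b a)))
      by (rewrite Fh_cmp; reflexivity).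
    set (L := csqv (csqh (csqv1 (unitH X))
                      (@sqcast (comma_data F) _ _ _ _ _ _ _ _ _ _ _ _ eq_refl E
                        eq_refl eq_refl (secC (fh F a) (fh F b))))
                (unitT (hcmp b a))).
    set (R := csqv (csqv (@sqcast (comma_data F) _ _ _ _ _ _ _ _ _ _ _ _ eq_refl
                        (chcmpA (trivH F a) (unitH Y) (secH (fh F b)))
                        eq_refl eq_refl (csqh (unitT a) (csqv1 (secH (fh F b)))))
                      (csqh (csqv1 (trivH F a)) (unitT b)))
                (@sqcast (comma_data F) _ _ _ _ _ _ _ _ _ _ _ _
                        (chcmpA (trivH F a) (trivH F b) (unitH Z)) eq_refl
                        eq_refl eq_refl
                        (csqh (csqv1 (chcmp (trivH F b) (trivH F a))) (csqv1 (unitH Z))))).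
    (* Once the sides are recognised as parts of [L] and [R], uniqueness applies, because in [B]
       both reduce to an identity square. *)
    transitivity <[sa L]>; [|transitivity <[sa R]>].
    + unfold L. sas. pk. cbn [compGF idD pcomp punit]. pk. reflexivity.
    + over L R; try ebd.
      unfold L, R. esbs. simpl. rewrite !unitH_b, Fh_cmp, <- !pk_v1_hcmp.
      autorewrite with dbl. rewrite !(vc1l (ty_pk (sqv1 _)) eq_refl). reflexivity.
    + unfold R. sas. pk. reflexivity.
  - apply pk_JMeq.
    assert (E : secH (hid (fo F X)) = secH (fh F (hid X)))
      by (rewrite Fh_id; reflexivity).
    set (L := csqv (csqh (csqv1 (unitH X))
                      (@sqcast (comma_data F) _ _ _ _ _ _ _ _ _ _ _ _ eq_refl E
                        eq_refl eq_refl (secU (fo F X))))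
                (unitT (hid X))).
    set (R := csqh (csqv1 (chid (trivO F X))) (csqv1 (unitH X))).
    transitivity <[sa L]>; [|transitivity <[sa R]>].
    + unfold L. sas. pk. cbn [compGF idD pcomp punit]. pk. reflexivity.
    + over L R; try ebd.
      unfold L, R. esbs. simpl. rewrite !unitH_b, Fh_id, <- !pk_v1_hcmp.
      autorewrite with dbl. apply (vc1l (ty_pk (sqv1 _)) eq_refl).
    + unfold R. sas. pk. reflexivity.
Qed.

Definition unit_nt : HPNT (idD A) (compGF quasi_inv F) := MkHPNT unit_nt_ax.

Lemma unit_nt_equiv : hpnt_equiv unit_nt.
Proof.
  assert (W : forall (X Y : ob A) (u : ver X Y), wh_inv (tv unit_nt u)).
  { intros X Y u. apply (@sa_wh_inv _ _ _ HF _ _ _ _ _ _ _ _ (unitV u)).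
    - apply trivV_wh.
    - apply secV_wh.
    - eapply wh_inv_transport; [symmetry; apply sb_unitV | apply wh_inv_sqh1]. }
  split; [|exact W].
  (* The component at [X] is the top of the weakly invertible square at the vertical identity. *)
  intros X. exact (proj1 (wh_inv_hequiv (W _ _ (vid X)))).
Qed.

End Inverse.

(** * Choosing a section *)

Lemma dependent_choice (X : Type) (T : X -> Type) (P : forall x, T x -> Prop) :
  (forall x, exists y, P x y) -> exists f : forall x, T x, forall x, P x (f x).
Proof.
  intros H.
  exists (fun x => proj1_sig (constructive_indefinite_description _ (H x))).
  intros x. exact (proj2_sig (constructive_indefinite_description _ (H x))).
Qed.

Lemma override (X : Type) (T : X -> Type) (f : forall x, T x) (x0 : X) (y0 : T x0) :
  exists g : forall x, T x, g x0 = y0 /\ forall x, x <> x0 -> g x = f x.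
Proof.
  (* The prescribed value lives over [x0], so over [x] it is stated by transport along any proof of
     [x0 = x]; proof irrelevance makes them all agree. *)
  enough (H : forall x, exists y : T x,
            (forall e : x0 = x, eq_rect x0 T y0 x e = y) /\ (x <> x0 -> y = f x)).
  { apply dependent_choice in H. destruct H as [g Hg]. exists g. split.
    - symmetry. exact (proj1 (Hg x0) eq_refl).
    - intros x. apply Hg. }
  intros x. destruct (classic (x0 = x)) as [<-|n].
  - exists y0. split; [|congruence]. intros e. rewrite (proof_irrelevance _ e eq_refl).
    reflexivity.
  - exists (f x). split; [contradiction | auto].
Qed.

(** * Vertical morphisms in a disjoint union of points and arrows *)

Section Vertical.
Context (B : DblCat) (HB : vdisj12 B).

Lemma ver_unique (Y Y' : ob B) (u v : ver Y Y') : u = v.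
Proof.
  destruct HB as (I & k & phi & _ & _ & _ & H).
  destruct (H Y Y') as [H1 H2]. destruct (H1 (H2 u)) as [w Hw].
  rewrite (Hw u), (Hw v). reflexivity.
Qed.

Lemma ver_components : exists (I : Type) (idx : ob B -> I),
  (forall Y Y' : ob B, ver Y Y' -> idx Y = idx Y') /\
  (forall Y Y' Z Z' : ob B, ver Y Y' -> Y <> Y' -> ver Z Z' -> Z <> Z' ->
     idx Y = idx Z -> Y = Z /\ Y' = Z').
Proof.
  destruct HB as (I & k & phi & _ & _ & inj & H).
  exists I, (fun Y => fst (phi Y)).
  assert (E : forall Y Y' : ob B, ver Y Y' -> fst (phi Y) = fst (phi Y')).
  { intros Y Y' v. apply H, v. }
  (* Between distinct objects a morphism runs from [false] to [true] in its component, so the index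
     determines both ends. *)
  assert (N : forall Y Y' : ob B, ver Y Y' -> Y <> Y' ->
            snd (phi Y) = false /\ snd (phi Y') = true).
  { intros Y Y' v n. destruct (proj2 (H Y Y') v) as [e1 e2].
    assert (phi Y <> phi Y') by auto.
    destruct (phi Y) as [i [|]], (phi Y') as [j [|]]; simpl in *; subst; intuition congruence. }
  split; [exact E|].
  intros Y Y' Z Z' v n w m e.
  destruct (N _ _ v n) as [a1 a2], (N _ _ w m) as [b1 b2].
  pose proof (E _ _ v) as e1. pose proof (E _ _ w) as e2.
  split.
  - apply inj. rewrite (surjective_pairing (phi Y)), (surjective_pairing (phi Z)). congruence.
  - apply inj. rewrite (surjective_pairing (phi Y')), (surjective_pairing (phi Z')). congruence.
Qed.

(** Two composable morphisms between distinct objects would lie in one component and hence share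
    their source. *)
Lemma ver_no_composite (X Y Z : ob B) : ver X Y -> ver Y Z -> X = Y \/ Y = Z.
Proof.
  intros u v. destruct ver_components as (I & idx & E & N).
  destruct (classic (X = Y)) as [|n]; [auto|].
  destruct (classic (Y = Z)) as [|m]; [auto|].
  destruct (N X Y Y Z u n v m (E _ _ u)) as (e & _). contradiction.
Qed.

End Vertical.

(** * A section that is strict on vertical morphisms *)

Section Choice.
Context (A B : DblCat) (HB : vdisj12 B) (F : DFun A B) (HF : double_biequiv F).

Definition over (Y : ob B) := {X : ob A & {e : hom (fo F X) Y | hequiv e}}.
Definition over_cob (Y : ob B) (x : over Y) : cob F := MkCob (proj2_sig (projT2 x)).

Definition vlift (Y Y' : ob B) (x : over Y) (x' : over Y') (v : ver Y Y')
  (u : cver (over_cob x) (over_cob x')) : Prop := vb u = v /\ wh_inv (vs u).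

Lemma over_exists (Y : ob B) : exists x : over Y, True.
Proof.
  destruct HF as (db1 & _). destruct (db1 Y) as (X & f & Hf).
  destruct Hf as (g & s & t & Hs & Ht).
  unshelve eexists (existT _ X (exist _ g _)); auto. exists f, t, s. auto.
Qed.

(** The square from (db3) ends at an image under [F], so its inverse [be] is the lift; weak
    invertibility makes the top and bottom of [be] equivalences. *)
Lemma vlift_exists (Y Y' : ob B) (v : ver Y Y') :
  exists (x : over Y) (x' : over Y') (u : cver (over_cob x) (over_cob x')), vlift v u.
Proof.
  destruct HF as (_ & _ & db3 & _).
  destruct (db3 _ _ v) as (X & X' & u & a & b & s & c & d & be & H & H').
  assert (W : wh_inv be) by (exists a, b, s; split; assumption).
  destruct (wh_inv_hequiv W) as [Hc Hd].
  exists (existT _ X (exist _ c Hc)), (existT _ X' (exist _ d Hd)).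
  exists (@MkCver _ _ F (over_cob (existT _ X (exist _ c Hc)))
     (over_cob (existT _ X' (exist _ d Hd))) v u be).
  split; [reflexivity | exact W].
Qed.

(** A lift of a vertical morphism prescribes the objects over its ends. Each component has at most
    one morphism between distinct objects, so the prescriptions never conflict. *)
Lemma section_objects : exists sO : forall Y : ob B, over Y,
  forall (Y Y' : ob B) (v : ver Y Y'), Y <> Y' ->
    exists u : cver (over_cob (sO Y)) (over_cob (sO Y')), vlift v u.
Proof.
  destruct (dependent_choice over_exists) as [o _].
  destruct (ver_components HB) as (I & idx & E & N).
  assert (H : forall i : I, exists s : forall Y : ob B, over Y,
    forall (Y Y' : ob B) (v : ver Y Y'), idx Y = i -> Y <> Y' ->
      exists u : cver (over_cob (s Y)) (over_cob (s Y')), vlift v u).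
  { intros i.
    destruct (classic (exists (Y Y' : ob B) (v : ver Y Y'), idx Y = i /\ Y <> Y'))
      as [(Y0 & Y1 & v & e & n) | none].
    - destruct (vlift_exists v) as (x & x' & u & Hu).
      (* The default choice is overridden at both ends; by [n] the second override keeps the value
         at [Y0]. *)
      destruct (override o x) as (o1 & Ho1 & _).
      destruct (override o1 x') as (o2 & Ho2 & Ho2').
      exists o2. intros Y Y' w e' m.
      destruct (N Y0 Y1 Y Y' v n w m (eq_trans e (eq_sym e'))) as (<- & <-).
      rewrite <- (ver_unique HB v w), (Ho2' _ n), Ho1, Ho2. exists u. exact Hu.
    - exists o. intros Y Y' w e' m. destruct none. eauto 6. }
  apply dependent_choice in H. destruct H as [s Hs].
  (* Each object follows the choice for its own component, which no vertical morphism leaves. *)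
  exists (fun Y => s (idx Y) Y). intros Y Y' v n.
  rewrite <- (E _ _ v). apply Hs; auto.
Qed.

Lemma section_exists : exists (sO : forall Y : ob B, over Y)
  (gV : forall Y Y' : ob B, ver Y Y' -> cver (secO sO Y) (secO sO Y'))
  (gH : forall Y Y' : ob B, hom Y Y' -> chom (secO sO Y) (secO sO Y')),
  (forall (Y Y' : ob B) (v : ver Y Y'), vb (gV Y Y' v) = v) /\
  (forall (Y Y' : ob B) (v : ver Y Y'), wh_inv (vs (gV Y Y' v))) /\
  (forall Y : ob B, gV Y Y (vid Y) = cvid (secO sO Y)) /\
  (forall (X Y Z : ob B) (u : ver X Y) (v : ver Y Z),
      gV X Z (vcmp v u) = cvcmp (gV Y Z v) (gV X Y u)) /\
  (forall (Y Y' : ob B) (b : hom Y Y'), hb (gH Y Y' b) = b) /\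
  (forall Y : ob B, gH Y Y (hid Y) = chid (secO sO Y)).
Proof.
  destruct section_objects as [sO HO]. exists sO.
  (* Ends and morphism are packed into a single index for the choice. With equal ends [v] is an
     identity by thinness and its lift is forced to be one; [JMeq] states this before the ends are
     identified. *)
  assert (HV : forall z : {Y : ob B & {Y' : ob B & ver Y Y'}},
    let Y := projT1 z in let Y' := projT1 (projT2 z) in let v := projT2 (projT2 z) in
    exists u : cver (secO sO Y) (secO sO Y'),
      vb u = v /\ wh_inv (vs u) /\ (Y = Y' -> JMeq u (cvid (secO sO Y)))).
  { intros (Y & Y' & v); simpl. destruct (classic (Y = Y')) as [<-|n].
    - exists (cvid (secO sO Y)). split; [apply (ver_unique HB)|].
      split; [exact (cvid_wh_inv (secO sO Y)) | reflexivity].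
    - destruct (HO _ _ v n) as (u & H1 & H2). exists u. repeat split; auto. contradiction. }
  (* Identities are lifted to identities, for normality; any other horizontal morphism gets an
     arbitrary lift. *)
  assert (HH : forall z : {Y : ob B & {Y' : ob B & hom Y Y'}},
    let Y := projT1 z in let Y' := projT1 (projT2 z) in let b := projT2 (projT2 z) in
    exists h : chom (secO sO Y) (secO sO Y'),
      hb h = b /\ (Y = Y' -> JMeq b (hid Y) -> JMeq h (chid (secO sO Y)))).
  { intros (Y & Y' & b); simpl.
    destruct (classic (Y = Y' /\ JMeq b (hid Y))) as [[<- e]|n].
    - apply JMeq_eq in e. subst b. exists (chid (secO sO Y)). auto.
    - destruct (@hom_lift_exists _ _ _ HF (secO sO Y) (secO sO Y') b) as [h Hh].
      exists h. split; [exact Hh | tauto]. }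
  apply dependent_choice in HV. destruct HV as [gV HV].
  apply dependent_choice in HH. destruct HH as [gH HH].
  exists (fun Y Y' v => gV (existT _ Y (existT _ Y' v))),
    (fun Y Y' b => gH (existT _ Y (existT _ Y' b))).
  assert (Vid : forall Y : ob B, gV (existT _ Y (existT _ Y (vid Y))) = cvid (secO sO Y)).
  { intros Y. apply JMeq_eq. exact (proj2 (proj2 (HV (existT _ Y (existT _ Y (vid Y))))) eq_refl). }
  repeat split.
  - intros Y Y' v. exact (proj1 (HV (existT _ Y (existT _ Y' v)))).
  - intros Y Y' v. exact (proj1 (proj2 (HV (existT _ Y (existT _ Y' v))))).
  - exact Vid.
  (* One factor is an identity, so strict preservation of composites reduces to a unit law. *)
  - intros X Y Z u v. destruct (ver_no_composite HB u v) as [e|e]; subst.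
    + rewrite (ver_unique HB u (vid Y)), v1r, Vid, cvcmp1r. reflexivity.
    + rewrite (ver_unique HB v (vid Z)), v1l, Vid, cvcmp1l. reflexivity.
  - intros Y Y' b. exact (proj1 (HH (existT _ Y (existT _ Y' b)))).
  - intros Y. apply JMeq_eq.
    exact (proj2 (HH (existT _ Y (existT _ Y (hid Y)))) eq_refl JMeq_refl).
Qed.

End Choice.

Theorem theoremB (A B : DblCat) (HB : vdisj12 B) (F : DFun A B) :
  double_biequiv F <->
  exists G : HPF B A, hpf_normal G /\
    exists (eta : HPNT (idD A) (compGF G F)) (eps : HPNT (compFG F G) (idD B)),
      hpnt_equiv eta /\ hpnt_equiv eps.
Proof.
  split.
  - intros HF.
    destruct (section_exists HB HF) as (sO & gV & gH & V1 & V2 & V3 & V4 & H1 & H2).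
    exists (quasi_inv HF V1 V2 V3 V4 H1). split; [exact (quasi_inv_normal HF V1 V2 V3 V4 H1 H2)|].
    exists (unit_nt HF V1 V2 V3 V4 H1), (counit_nt HF V1 V2 V3 V4 H1).
    split; [apply unit_nt_equiv | apply counit_nt_equiv].
  - intros (G & _ & eta & eps & H1 & H2).
    exact (double_biequiv_of_equivalence H1 H2).
Qed.
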